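(* Let $d\ge 2$, let $b,\zeta\in C^1_\sharp(Y_d)^d$, let $X$ be the flow associated with $b$, and let $\Phi\in C^1(\mathbb{R}^d)^d$. Then the following two assertions are equivalent: (1) for all $t\ge 0$ and all $x\in\mathbb{R}^d$, $X(t,x)=x+t\,\zeta(x)+\Phi\big(X(t,x)\big)-\Phi(x)$; (2) $(I_d-\nabla\Phi)\,b=\zeta$ in $\mathbb{R}^d$, and for all $t\ge 0$, $\zeta\big(X(t,\cdot)\big)=\zeta$ in $Y_d$ (that is, $\zeta$ is invariant for the flow $X$). Moreover, if one of these two assertions is satisfied and $\Phi$ is bounded in $\mathbb{R}^d$, then $\zeta$ is $\mathbb{Z}^d$-periodic, the Herman rotation set $\mathsf{C}_b$ is given by $$\mathsf{C}_b=\begin{cases}\mathrm{conv}\big(\zeta(Y_d)\big) & \text{if } d\ge 3,\\ \zeta(Y_2) & \text{if } d=2,\end{cases}$$ and the flow $X$ admits the fine asymptotic expansion with this $\zeta$, i.e. there is a constant $C\ge 0$ such that $|X(t,x)-x-t\,\zeta(x)|\le C$ for all $t\ge 0$ and all $x\in\mathbb{R}^d$.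
   Context: $Y_d=\mathbb{R}^d/\mathbb{Z}^d$ is the $d$-dimensional torus. $C^k_\sharp(Y_d)$ denotes the space of $\mathbb{Z}^d$-periodic real functions in $C^k(\mathbb{R}^d)$, and $C^k_\sharp(Y_d)^d$ the corresponding vector fields on $\mathbb{R}^d$. For $b\in C^1_\sharp(Y_d)^d$, the flow $X$ associated with $b$ is the solution of $\frac{\partial X}{\partial t}(t,x)=b(X(t,x))$, $X(0,x)=x$, for $x\in\mathbb{R}^d$; since $X(t,x+k)=X(t,x)+k$ for $k\in\mathbb{Z}^d$, it also induces a flow on $Y_d$. $\nabla\Phi$ is the Jacobian matrix with entries $\partial\Phi_i/\partial x_j$, and $I_d$ is the identity matrix. The Herman rotation set of $b$ is $\mathsf{C}_b:=\{\int_{Y_d}b(x)\,\mu(dx)\}$, where $\mu$ runs over the Borel probability measures on $Y_d$ that are invariant for the flow, i.e. $\mu\circ X(t,\cdot)=\mu$ for any $t\ge 0$. $\mathrm{conv}$ denotes the convex hull, and $|\cdot|$ the euclidean norm. *)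

(* Defs.v *)
From HB Require Import structures.
From mathcomp Require Import all_boot all_order all_algebra.
From mathcomp Require Import all_classical all_reals all_analysis.

Set Implicit Arguments.
Unset Strict Implicit.
Unset Printing Implicit Defensive.

Import Order.TTheory GRing.Theory Num.Theory.
Import numFieldNormedType.Exports.

Local Open Scope classical_set_scope.
Local Open Scope ring_scope.
Local Open Scope quotient_scope.

Section vector_fields.
Context {R : realType} {d : nat}.
Implicit Types (f : 'cV[R]_d -> 'cV[R]_d) (x : 'cV[R]_d).

(* The norm carried by the normedModType 'cV[R]_d is the sup norm. *)
Definition enorm x : R := Num.sqrt (\sum_(i < d) x i 0 ^+ 2).

(* The library's [jacobian] is the transpose of this one, for row vectors. *)
Definition jac f x : 'M[R]_d :=
  \matrix_(i < d, j < d) 'D_(delta_mx j 0) (fun y => f y i 0) x.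

Definition C1 f : Prop :=
  (forall x, differentiable f x) /\ continuous (jac f).

Definition Zd_periodic f : Prop :=
  forall x (k : 'cV[int]_d), f (x + map_mx intr k) = f x.

Definition C1_per f : Prop := Zd_periodic f /\ C1 f.

(* Solutions are global in both time directions when f is C1 and periodic. *)
Definition is_flow f (X : R -> 'cV[R]_d -> 'cV[R]_d) : Prop :=
  forall x, X 0 x = x /\
    forall t : R, is_derive t (1 : R) (fun s => X s x) (f (X t x)).

Definition conv_hull (A : set 'cV[R]_d) : set 'cV[R]_d :=
  smallest (@convex_set R 'cV[R]_d) A.

End vector_fields.

Section torus.
Context (R : realType) (d : nat).

Definition congZ (x y : 'cV[R]_d) : bool :=
  `[< exists k : 'cV[int]_d, y = x + map_mx intr k >].

Lemma congZ_refl : reflexive congZ.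
Proof. by move=> x; apply/asboolP; exists 0; rewrite map_mx0 addr0. Qed.

Lemma congZ_sym : symmetric congZ.
Proof.
suff H x y : congZ x y -> congZ y x by move=> x y; apply/idP/idP; exact: H.
move=> /asboolP[k ->]; apply/asboolP; exists (- k).
by rewrite map_mxN addrK.
Qed.

Lemma congZ_trans : transitive congZ.
Proof.
move=> y x z /asboolP[k ->] /asboolP[l ->]; apply/asboolP; exists (k + l).
by rewrite map_mxD addrA.
Qed.

Canonical congZ_equiv := EquivRel congZ congZ_refl congZ_sym congZ_trans.

Definition torus : Type := quotient_topology {eq_quot congZ_equiv}.

HB.instance Definition _ := PointedTopological.on torus.
HB.instance Definition _ := Quotient.on torus.

Definition borel_torus : Type := g_sigma_algebraType (@open torus).
HB.instance Definition _ := Measurable.on borel_torus.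

(* The choice of representative is irrelevant as soon as [f] is periodic,
   resp. as soon as [X t] commutes with integer translations, which holds for
   the flow of a periodic vector field. *)
Definition on_torus (f : 'cV[R]_d -> 'cV[R]_d) (y : torus) : 'cV[R]_d :=
  f (repr y).

Definition torus_flow (X : R -> 'cV[R]_d -> 'cV[R]_d) (t : R) (y : torus) :
  torus := \pi_torus (X t (repr y)).

(* Invariance as equality of [mu] with its pushforward by [X t]; each [X t] is
   a bijection of the torus, so images could be used instead of preimages. *)
Definition flow_invariant (X : R -> 'cV[R]_d -> 'cV[R]_d)
    (mu : probability borel_torus R) : Prop :=
  forall t : R, 0 <= t -> forall A : set borel_torus, measurable A ->
    mu (torus_flow X t @^-1` A) = mu A.

Definition herman_rotation_set (b : 'cV[R]_d -> 'cV[R]_d)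
    (X : R -> 'cV[R]_d -> 'cV[R]_d) : set 'cV[R]_d :=
  [set \col_(i < d) (\int[mu]_y on_torus b y i 0)%R
    | mu in [set mu | flow_invariant X mu]].

End torus.

(* Main.v *)
Require Import Defs.
From HB Require Import structures.
From mathcomp Require Import all_boot all_order all_algebra.
From mathcomp Require Import all_classical all_reals all_analysis.
From mathcomp Require Import measurable_realfun ring lra zify.
Import Order.TTheory GRing.Theory Num.Theory.
Import numFieldNormedType.Exports.
Local Open Scope classical_set_scope.
Local Open Scope ring_scope.
Set Implicit Arguments.
Unset Strict Implicit.
Unset Printing Implicit Defensive.

(** The map [x - Phi x] straightens the orbits: the derivative of
    [X t x - Phi (X t x) - t *: zeta x] in [t] is
    [(1 - jac Phi (X t x)) *m b (X t x) - zeta x]. Assertion (1) says that this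
    function of [t] is constant, assertion (2) that its derivative vanishes
    ([linear_conjugacy_diff]). If moreover [Phi] is bounded, then
    [X t x - x - t *: zeta x = Phi (X t x) - Phi x] is bounded, which is the
    asymptotic expansion. As [Phi] is not periodic, it has no mean on the torus;
    the rotation set is computed from this bound and the invariance of [zeta].

    Let [mu] be an invariant probability measure. The displacement error
    [th t x = X t x - x - t *: zeta x] is periodic and additive along the flow,
    so its mean over [mu] is additive in [t]; being bounded, this mean is zero.
    As [th h = h *: (b - zeta) + O(h ^ 2)], the means of [b] and [zeta] are
    equal ([rotation_vectorE]). The mean of [zeta] lies in the convex hull of
    its range: the range is compact, so is its hull by Caratheodory's theorem,
    and a point outside would be separated from it by a hyperplane
    ([barycenter_conv_hull]).

    Conversely, for each [x] there is an invariant probability measure which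
    gives mass one to every closed set containing the orbit of [x]
    ([krylov_bogoliubov]); on it, [zeta] is almost everywhere equal to [zeta x].
    So [zeta x] belongs to the rotation set, which is convex because mixtures of
    invariant measures are invariant. The invariant measure comes from the
    asymptotic frequencies of visits of the orbit, taken along an ultrafilter.
    These frequencies are only finitely additive, and they are made countably
    additive by lifting them to the Cantor space through a continuous
    surjection onto the torus: on the algebra of clopen sets, finite additivity
    implies countable additivity by compactness ([clopen_measure]).

    The rotation set is thus [conv_hull (range zeta)] in every dimension, and
    for [d = 2] it remains to see that the range of [zeta] is already convex. If
    [zeta x] and [zeta y] were not aligned, the orbits of [x] and [y] in the
    plane would stay at bounded distance from two lines which are not parallel,
    hence they would meet, by the Poincare-Miranda theorem
    ([poincare_miranda]); this is absurd since [zeta] is constant on orbits. So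
    the range of [zeta] is a connected subset of a line through the origin
    ([range_convex_planar]). *)

(** * Column vectors, mean value inequalities and periodic maps *)

Section sup_norm.
Context {R : realType} {m n : nat}.
Implicit Types A : 'M[R]_(m, n).

Lemma mx_entry_le A i j : `|A i j| <= `|A|.
Proof.
rewrite [leRHS]/Num.Def.normr/= mx_normrE.
exact: (le_bigmax _ (fun ij : 'I_m * 'I_n => `|A ij.1 ij.2|) (i, j)).
Qed.

Lemma mx_norm_le A M : 0 <= M -> (forall i j, `|A i j| <= M) -> `|A| <= M.
Proof.
move=> M0 AM; rewrite [leLHS]/Num.Def.normr/= mx_normrE.
by rewrite (bigmax_le _ M0)//= => -[i j] _; exact: AM.
Qed.

Lemma is_derive_mxP (f : R -> 'M[R]_(m, n)) (t : R) (df : 'M[R]_(m, n)) :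
  is_derive t (1 : R) f df <->
  forall i j, is_derive t (1 : R) (fun s => f s i j) (df i j).
Proof.
split=> [[/[dup] fd /derivable_mxP fd' fE] i j|H].
  apply: DeriveDef; first exact: fd'.
  by rewrite -fE derive_mx// mxE.
have fd : derivable f t 1 by apply/derivable_mxP => i j; case: (H i j).
apply: DeriveDef => //; rewrite derive_mx//; apply/matrixP => i j.
by rewrite mxE; case: (H i j).
Qed.

Lemma mx_continuousP (T : topologicalType) (f : T -> 'M[R]_(m, n)) :
  (forall i j, continuous (fun t => f t i j)) -> continuous f.
Proof.
move=> cf t; apply/cvgrPdist_le => /= e e0.
near=> s; apply: mx_norm_le; first exact: ltW.
move=> i j; rewrite !mxE; move: i j.
near: s; apply: filter_forall => i; apply: filter_forall => j.
by have /cvgrPdist_le := cf i j t; exact.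
Unshelve. all: by end_near. Qed.

End sup_norm.

Lemma continuous_entry (R : realType) (d : nat) (T : topologicalType) (f : T -> 'cV[R]_d) i :
  continuous f -> continuous (fun x => f x i 0).
Proof.
move=> cf x; apply: (@continuous_comp _ _ _ f (fun M : 'cV[R]_d => M i 0) x (cf x)).
exact: coord_continuous.
Qed.

Lemma continuous_bigsum (R : realType) (T : topologicalType) n (g : 'I_n -> T -> R) :
  (forall i, continuous (g i)) -> continuous (fun x => \sum_i g i x).
Proof.
move=> cg; apply: continuous_big => // x; exact: add_continuous.
Qed.

Section euclidean_norm.
Context {R : realType} {d : nat}.
Implicit Types v : 'cV[R]_d.

Lemma norm_le_enorm v : `|v| <= enorm v.
Proof.
apply: mx_norm_le => [|i j]; first exact: sqrtr_ge0.
rewrite (ord1 j) -sqrtr_sqr ler_wsqrtr// (bigD1 i)//= lerDl.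
by apply: sumr_ge0 => k _; exact: sqr_ge0.
Qed.

Lemma enorm_le_norm v : enorm v <= Num.sqrt d%:R * `|v|.
Proof.
rewrite -[`|v|]ger0_norm// -sqrtr_sqr -sqrtrM// ler_wsqrtr//.
apply: (@le_trans _ _ (\sum_(i < d) `|v| ^+ 2)).
  apply: ler_sum => i _; rewrite -[leLHS]real_normK ?num_real//.
  by rewrite lerXn2r ?nnegrE// mx_entry_le.
by rewrite sumr_const card_ord mulr_natl.
Qed.

End euclidean_norm.

Lemma MVT_real (R : realType) (f df : R -> R) (a b : R) :
  (forall t, is_derive t (1 : R) f (df t)) -> a <= b ->
  exists2 c, a <= c <= b & f b - f a = df c * (b - a).
Proof.
move=> fd ab; have fc : {within `[a, b], continuous f}.
  apply: continuous_subspaceT => x; apply: differentiable_continuous.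
  by apply/derivable1_diffP; case: (fd x).
have [c] := @MVT_segment R f df a b ab (fun x _ => fd x) fc.
by rewrite in_itv/= => cab E; exists c.
Qed.

Lemma mx_MVT_le (R : realType) (m n : nat) (f df : R -> 'M[R]_(m, n)) (B : R) :
  (forall t, is_derive t (1 : R) f (df t)) -> (forall t, `|df t| <= B) ->
  forall s t, `|f t - f s| <= B * `|t - s|.
Proof.
move=> fd dfB; have B0 : 0 <= B := le_trans (normr_ge0 _) (dfB 0).
suff H s t : s <= t -> `|f t - f s| <= B * `|t - s|.
  move=> s t; have [/H//|/ltW/H] := leP s t.
  by rewrite distrC [X in _ * X]distrC.
move=> st; apply: mx_norm_le => [|i j]; first exact: mulr_ge0.
have [//|c _] := @MVT_real R (fun t => f t i j) (fun t => df t i j) s t _ st.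
  by move=> r; exact: (is_derive_mxP _ _ _).1.
rewrite !mxE => ->; rewrite normrM ler_pM//.
exact: le_trans (mx_entry_le _ _ _) (dfB _).
Qed.

Section chain_rule.
Context {R : realType} {d : nat}.
Implicit Types (f : 'cV[R]_d -> 'cV[R]_d).

Lemma differentiable_entry f x i :
  differentiable f x -> differentiable (fun y => f y i 0) x.
Proof.
move=> fd.
exact: (@differentiable_comp _ _ _ _ f (fun M : 'cV[R]_d => M i 0)
  _ fd (differentiable_coord _ _ _)).
Qed.

Lemma derive_entry_jac f x v i : differentiable f x ->
  'D_v (fun y => f y i 0) x = (jac f x *m v) i 0.
Proof.
move=> /(differentiable_entry i) fd; rewrite deriveE//.
rewrite mxE; have {1}-> : v = \sum_j v j 0 *: delta_mx j 0.
  by rewrite [LHS]matrix_sum_delta; apply: eq_bigr => j _; rewrite big_ord1.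
rewrite linear_sum; apply: eq_bigr => j _.
by rewrite linearZ /= mulrC; congr (_ * _); rewrite mxE deriveE.
Qed.

Lemma is_derive_comp_jac f (g : R -> 'cV[R]_d) (t : R) (dg : 'cV[R]_d) :
  differentiable f (g t) -> is_derive t (1 : R) g dg ->
  is_derive t (1 : R) (f \o g) (jac f (g t) *m dg).
Proof.
move=> fd gd; apply/is_derive_mxP => i j; rewrite (ord1 j).
have fid := differentiable_entry i fd.
have dgt : differentiable g t by apply/derivable1_diffP; case: gd.
have -> : (fun s => (f \o g) s i 0) = (fun y => f y i 0) \o g by [].
have cd : differentiable ((fun y => f y i 0) \o g) t.
  exact: differentiable_comp.
apply: DeriveDef; first by apply/derivable1_diffP.
rewrite deriveE// diff_comp//= -derive_entry_jac// deriveE//; congr ('d _ _ _).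
by rewrite -deriveE//; case: gd.
Qed.

End chain_rule.

Section periodic.
Context {R : realType} {d : nat}.
Implicit Types (f : 'cV[R]_d -> 'cV[R]_d) (x : 'cV[R]_d).

Definition unit_cube : set 'cV[R]_d := [set x | forall i, 0 <= x i 0 <= 1].

Lemma unit_cube_rep x : exists k : 'cV[int]_d, unit_cube (x + map_mx intr k).
Proof.
exists (- \col_i Num.floor (x i 0)) => i; rewrite !mxE.
rewrite mulrNz; have := floor_le_tmp (x i 0); have := lt_succ_floor (x i 0).
rewrite intrD /= => h1 h2; lra.
Qed.

Lemma box_compact m n : compact [set A : 'M[R]_(m, n) | forall i j, 0 <= A i j <= 1].
Proof.
pose D := [set v : 'rV[R]_(m * n) | forall i, `[0, 1]%classic (v ord0 i)].
have cD : compact D.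
  by apply: (@rV_compact R _ (fun=> `[0, 1]%classic)) => i; exact: segment_compact.
suff -> : [set A : 'M[R]_(m, n) | forall i j, 0 <= A i j <= 1] = vec_mx @` D.
  apply: continuous_compact cD; apply: continuous_subspaceT.
  apply: mx_continuousP => i j v.
  under eq_fun do rewrite mxE.
  exact: coord_continuous.
apply/seteqP; split => [A AD|_ [v vD <-] i j].
  exists (mxvec A); last exact: mxvecK.
  move=> k; case/mxvec_indexP: k => i j; rewrite mxvecE /= in_itv /=.
  exact: AD.
by rewrite mxE; have := vD (mxvec_index i j); rewrite /= in_itv.
Qed.

Lemma unit_cube_compact : compact unit_cube.
Proof.
suff -> : unit_cube = [set A : 'M[R]_(d, 1) | forall i j, 0 <= A i j <= 1].
  exact: box_compact.
apply/seteqP; split => x /= H i; last exact: H.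
by move=> j; rewrite (ord1 j).
Qed.

Lemma periodic_bounded (W : normedModType R) (f : 'cV[R]_d -> W) :
  continuous f -> (forall x (k : 'cV[int]_d), f (x + map_mx intr k) = f x) ->
  exists B, forall x, `|f x| <= B.
Proof.
move=> cf pf.
have cube0 : unit_cube !=set0.
  by exists 0 => i; rewrite mxE lexx ler01.
have [|c _ cmax] := @compact_EVT_max _ _ (fun x => `|f x|) unit_cube cube0 unit_cube_compact.
  apply: continuous_subspaceT => x.
  by apply: (continuous_comp (cf x)); exact: norm_continuous.
exists `|f c| => x; have [k xk] := unit_cube_rep x.
by rewrite -(pf x k); apply: cmax; rewrite inE.
Qed.

(** The difference quotients themselves are periodic. *)
Lemma jac_periodic f : Zd_periodic f ->
  forall x (k : 'cV[int]_d), jac f (x + map_mx intr k) = jac f x.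
Proof.
move=> pf x k; apply/matrixP => i j; rewrite !mxE /derive.
set g1 := (X in X @ _); set g2 := (X in _ = lim (X @ _)).
suff -> : g1 = g2 by [].
by apply/funext => h; rewrite /g1 /g2 /= addrA !pf.
Qed.

Lemma mulmx_norm_le (A : 'M[R]_d) (v : 'cV[R]_d) : `|A *m v| <= d%:R * `|A| * `|v|.
Proof.
apply: mx_norm_le => [|i j]; first by rewrite !mulr_ge0.
rewrite mxE.
rewrite (le_trans (ler_norm_sum _ _ _))//.
apply: (@le_trans _ _ (\sum_(k < d) `|A| * `|v|)).
  by apply: ler_sum => k _; rewrite normrM ler_pM// mx_entry_le.
by rewrite sumr_const card_ord -mulrA mulr_natl.
Qed.

(** The Jacobian matrix is bounded, as it is continuous and periodic; the mean
    value inequality on the segment from [y] to [x] does the rest. *)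
Lemma C1_per_lipschitz f : C1_per f ->
  exists2 L, 0 <= L & forall x y, `|f x - f y| <= L * `|x - y|.
Proof.
move=> [pf [fd cj]].
have [B jB] := periodic_bounded cj (jac_periodic pf).
have B0 : 0 <= B := le_trans (normr_ge0 _) (jB 0).
exists (d%:R * B) => [|x y]; first exact: mulr_ge0.
pose g (s : R) := y + s *: (x - y).
have gd s : is_derive s (1 : R) g (x - y).
  apply/is_derive_mxP => i j.
  have -> : (fun r : R => g r i j) = cst (y i j) + (fun r => r * (x - y) i j).
    by apply/funext => r; rewrite /g !mxE.
  apply: is_derive_eq.
  by rewrite /GRing.scale /= mulr0 !add0r mulr1.
have fgd s : is_derive s (1 : R) (f \o g) (jac f (g s) *m (x - y)).
  exact: is_derive_comp_jac.
have := mx_MVT_le fgd (B := d%:R * B * `|x - y|) _ 0 1.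
rewrite /g /= scale1r scale0r addr0 subr0 normr1 mulr1 subrKC; apply => s.
apply: le_trans (mulmx_norm_le _ _) _.
by rewrite ler_wpM2r// ler_wpM2l.
Qed.

End periodic.

(** * Flows of periodic vector fields *)

Section gronwall.
Context {R : realType} {d : nat}.
Variables (b : 'cV[R]_d -> 'cV[R]_d) (L : R).
Hypotheses (L0 : 0 <= L) (bL : forall x y, `|b x - b y| <= L * `|x - y|).
Variables (u v : R -> 'cV[R]_d).
Hypotheses (ud : forall t, is_derive t (1 : R) u (b (u t)))
           (vd : forall t, is_derive t (1 : R) v (b (v t))).

Let w (t : R) := \sum_(i < d) (u t i 0 - v t i 0) ^+ 2.
Let dw (t : R) := \sum_(i < d)
  (2 * (u t i 0 - v t i 0) * (b (u t) i 0 - b (v t) i 0)).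
Let M : R := 2 * d%:R * L.

Let w_derive t : is_derive t (1 : R) w (dw t).
Proof.
have -> : w = \sum_(i < d) (fun t => (u t i 0 - v t i 0) ^+ 2).
  by apply/funext => s; rewrite fct_sumE.
apply: is_derive_sum => i.
have ui := (is_derive_mxP _ _ _).1 (ud t) i 0.
have vi := (is_derive_mxP _ _ _).1 (vd t) i 0.
have -> : (fun t => (u t i 0 - v t i 0) ^+ 2) =
   ((fun t => u t i 0) - (fun t => v t i 0)) ^+ 2.
  by apply/funext => s.
by apply: is_derive_eq; rewrite /GRing.scale /= expr1 mulr_natl.
Qed.

Let norm2_le_w t : `|u t - v t| ^+ 2 <= w t.
Proof.
have w0 : 0 <= w t by apply: sumr_ge0 => i _; exact: sqr_ge0.
rewrite -[leRHS](sqr_sqrtr w0) ler_sqr ?nnegrE ?sqrtr_ge0//.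
apply: mx_norm_le => [|i j]; first exact: sqrtr_ge0.
rewrite (ord1 j) -sqrtr_sqr ler_wsqrtr// !mxE /w (bigD1 i)//= lerDl.
by apply: sumr_ge0 => k _; exact: sqr_ge0.
Qed.

Let dw_le t : `|dw t| <= M * w t.
Proof.
apply: (le_trans (ler_norm_sum _ _ _)).
apply: (@le_trans _ _ (\sum_(i < d) 2 * L * w t)); last first.
  by rewrite sumr_const card_ord -mulr_natl /M; lra.
apply: ler_sum => i _; rewrite !normrM ger0_norm// -!mulrA ler_wpM2l//.
apply: (le_trans _ (ler_wpM2l L0 (norm2_le_w t))); rewrite expr2 mulrA.
rewrite [leLHS]mulrC ler_pM//.
  by apply: le_trans (bL _ _); have := mx_entry_le (b (u t) - b (v t)) i 0; rewrite !mxE.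
by have := mx_entry_le (u t - v t) i 0; rewrite !mxE.
Qed.

Let expw_derive (c t : R) :
  is_derive t (1 : R) (fun s => expR (c * s) * w s) (expR (c * t) * (dw t + c * w t)).
Proof.
have -> : (fun s => expR (c * s) * w s) = (expR \o (c *: id)) * w by apply/funext.
have ? := w_derive t.
apply: is_derive_eq.
rewrite /GRing.scale /=; ring.
Qed.

(** The function [w], the square of the euclidean distance between the two
    solutions, is differentiable (the sup norm is not) and satisfies
    [`|w'| <= M * w] with [M = 2 * d * L]. So [expR (- M * t) * w t] decreases
    for [0 <= t], and [expR (M * t) * w t] increases for [t <= 0]. *)
Lemma gronwall t :
  `|u t - v t| ^+ 2 <= d%:R * expR (2 * d%:R * L * `|t|) * `|u 0 - v 0| ^+ 2.
Proof.
have wle s : - (M * w s) <= dw s <= M * w s by rewrite -ler_norml.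
have w0 : w 0 <= d%:R * `|u 0 - v 0| ^+ 2.
  apply: (@le_trans _ _ (\sum_(i < d) `|u 0 - v 0| ^+ 2)).
    apply: ler_sum => i _; rewrite -[leLHS]real_normK ?num_real// lerXn2r ?nnegrE//.
    by have := mx_entry_le (u 0 - v 0) i 0; rewrite !mxE.
  by rewrite sumr_const card_ord mulr_natl.
apply: (le_trans (norm2_le_w t)); rewrite mulrAC.
suff : w t <= expR (M * `|t|) * w 0.
  by move=> /le_trans; apply; rewrite mulrC ler_wpM2r// expR_ge0.
have [t0|/ltW t0] := leP 0 t.
- have [c _] := MVT_real (expw_derive (- M)) t0.
  rewrite mulr0 expR0 mul1r => E.
  have : expR (- M * t) * w t - w 0 <= 0.
    rewrite E subr0; apply: mulr_le0_ge0 => //.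
    apply: mulr_ge0_le0; first exact: expR_ge0.
    by have /andP[_ ] := wle c; rewrite mulNr subr_le0.
  rewrite subr_le0 -(ler_pM2l (expR_gt0 (M * t))) mulrA -expRD.
  by rewrite mulNr subrr expR0 mul1r (ger0_norm t0).
- have [c _] := MVT_real (expw_derive M) t0.
  rewrite mulr0 expR0 mul1r sub0r => E.
  have : 0 <= w 0 - expR (M * t) * w t.
    rewrite E mulr_ge0 ?oppr_ge0//.
    apply: mulr_ge0; first exact: expR_ge0.
    by have /andP[+ _] := wle c; rewrite -subr_ge0 opprK.
  rewrite subr_ge0 -(ler_pM2l (expR_gt0 (M * - t))) mulrA -expRD.
  by rewrite (ler0_norm t0) mulrN addNr expR0 mul1r.
Qed.

End gronwall.

Section flow.
Context {R : realType} {d : nat}.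
Variables (b : 'cV[R]_d -> 'cV[R]_d) (X : R -> 'cV[R]_d -> 'cV[R]_d).
Hypotheses (hb : C1_per b) (hX : is_flow b X).

Lemma C1_per_continuous (f : 'cV[R]_d -> 'cV[R]_d) : C1_per f -> continuous f.
Proof. by move=> [_ [fd _]] x; exact: differentiable_continuous. Qed.

Lemma C1_per_bounded (f : 'cV[R]_d -> 'cV[R]_d) : C1_per f ->
  exists2 B, 0 <= B & forall x, `|f x| <= B.
Proof.
move=> hf; have [|B fB] := periodic_bounded (C1_per_continuous hf); first by case: hf.
by exists B => //; exact: le_trans (normr_ge0 _) (fB 0).
Qed.

Lemma ode_unique (u v : R -> 'cV[R]_d) :
  (forall t, is_derive t (1 : R) u (b (u t))) ->
  (forall t, is_derive t (1 : R) v (b (v t))) -> u 0 = v 0 -> u = v.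
Proof.
move=> ud vd uv0; have [L L0 bL] := C1_per_lipschitz hb; apply/funext => t.
have := gronwall L0 bL ud vd t; rewrite uv0 subrr normr0 expr0n mulr0.
by rewrite real_exprn_even_le0//= normr_eq0 subr_eq0 => /eqP.
Qed.

Lemma flow0 x : X 0 x = x. Proof. by case: (hX x). Qed.

Lemma flow_derive x t : is_derive t (1 : R) (X ^~ x) (b (X t x)).
Proof. by case: (hX x). Qed.

(** Both sides solve the same equation in [t] and agree at [t = 0]; likewise in
    [flow_translate]. *)
Lemma flowD t s x : X (t + s) x = X t (X s x).
Proof.
have := @ode_unique (fun r => X (r + s) x) (X ^~ (X s x)).
move=> /(_ _ _ _)/(congr1 (@^~ t)); apply.
- move=> r; apply/is_derive_mxP => i j.
  have := (is_derive_mxP _ _ _).1 (flow_derive x (shift s r)) i j.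
  move=> /is_derive1_comp /(_ (is_derive_shift r 1 s)).
  by rewrite mulr1.
- exact: flow_derive.
- by rewrite add0r flow0.
Qed.

Lemma flowK t x : X (- t) (X t x) = x.
Proof. by rewrite -flowD addNr flow0. Qed.

Lemma flow_translate t x (k : 'cV[int]_d) :
  X t (x + map_mx intr k) = X t x + map_mx intr k.
Proof.
have := @ode_unique (X ^~ (x + map_mx intr k)) (fun t => X t x + map_mx intr k).
move=> /(_ _ _ _)/(congr1 (@^~ t)); apply.
- exact: flow_derive.
- move=> s; case: hb => pb _; rewrite pb -[b _]addr0.
  apply: is_deriveD; exact: flow_derive.
- by rewrite !flow0.
Qed.

Lemma flow_speed : exists2 B, 0 <= B & forall s t x, `|X t x - X s x| <= B * `|t - s|.
Proof.
have [B B0 bB] := C1_per_bounded hb; exists B => // s t x.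
exact: mx_MVT_le (flow_derive x) (fun t => bB (X t x)) _ _.
Qed.

Lemma flow_continuous t : continuous (X t).
Proof.
have [L L0 bL] := C1_per_lipschitz hb; move=> x.
apply/(@cvgrPdist_le _ _ _ (nbhs x) (nbhs_filter x)) => e e0.
pose K := d%:R * expR (2 * d%:R * L * `|t|) + 1.
have K0 : 0 < K by rewrite ltr_wpDl// mulr_ge0// expR_ge0.
have sK0 : 0 < Num.sqrt K by rewrite sqrtr_gt0.
near=> y.
have : `|X t x - X t y| ^+ 2 <= K * `|x - y| ^+ 2.
  apply: (le_trans (gronwall L0 bL (flow_derive x) (flow_derive y) t)).
  by rewrite !flow0 ler_wpM2r ?exprn_ge0// lerDl.
move=> /le_trans H; rewrite -(ler_pXn2r (n := 2))// ?nnegrE ?(ltW e0)//.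
apply: H; rewrite -[K]sqr_sqrtr ?(ltW K0)// -exprMn ler_pXn2r ?nnegrE ?(ltW e0)//.
- rewrite mulrC -ler_pdivlMr//; near: y.
  apply: (@cvgrPdist_le _ _ _ (nbhs x) (nbhs_filter x) id x).1 => //.
  by rewrite divr_gt0.
Unshelve. all: by end_near. Qed.

End flow.

(** * The two assertions, and the flow on the torus *)

(** Assertion (1) is about nonnegative times only, so that at [t = 0] it gives
    access to difference quotients from the right only. *)
Lemma right_cst_derive {R : realType} (f : R -> R) (t df : R) :
  is_derive t (1 : R) f df -> (forall s, t <= s -> f s = f t) -> df = 0.
Proof.
move=> [fd <-] fE; have /cvg_dnbhs_at_right cf := fd.
apply: (cvg_unique _ cf) => //.
apply: cvg_near_cst; near=> h.
rewrite /= fE ?subrr ?scaler0//.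
by rewrite [h%:A]mulr1 lerDr.
Unshelve. all: by end_near. Qed.

Section equivalence.
Context {R : realType} {d : nat}.
Variables (b zeta Phi : 'cV[R]_d -> 'cV[R]_d) (X : R -> 'cV[R]_d -> 'cV[R]_d).
Hypotheses (hb : C1_per b) (hX : is_flow b X) (hPhi : C1 Phi).

Let straightened_derive (x : 'cV[R]_d) (t : R) :
  is_derive t (1 : R) (fun s => X s x - Phi (X s x) - s *: zeta x)
    ((1%:M - jac Phi (X t x)) *m b (X t x) - zeta x).
Proof.
have dX := flow_derive hX x t.
have dPhi : is_derive t (1 : R) (Phi \o (X ^~ x)) (jac Phi (X t x) *m b (X t x)).
  by apply: is_derive_comp_jac => //; case: hPhi.
apply/is_derive_mxP => i j.
have dXi := (is_derive_mxP _ _ _).1 dX i j.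
have dPhii := (is_derive_mxP _ _ _).1 dPhi i j.
have -> : (fun s => (X s x - Phi (X s x) - s *: zeta x) i j) =
  (fun s => X s x i j) - (fun s => (Phi \o X^~ x) s i j) - (fun s => s * zeta x i j).
  by apply/funext => s; rewrite !mxE.
apply: is_derive_eq; rewrite mulmxBl mul1mx !mxE /GRing.scale /=; ring.
Qed.

(** At time zero the vanishing derivative gives [(1 - jac Phi) b = zeta]
    everywhere; at time [t] it then reads [zeta (X t x) = zeta x]. *)
Lemma linear_conjugacy_diff :
  (forall t : R, 0 <= t -> forall x, X t x = x + t *: zeta x + Phi (X t x) - Phi x) <->
  (forall x, (1%:M - jac Phi x) *m b x = zeta x) /\
  (forall t, 0 <= t -> forall x, zeta (X t x) = zeta x).
Proof.
pose g x (s : R) := X s x - Phi (X s x) - s *: zeta x.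
have gE x t : X t x = x + t *: zeta x + Phi (X t x) - Phi x <-> g x t = g x 0.
  rewrite /g (flow0 hX) scale0r subr0; move: (X t x) (Phi (X t x)) => A P.
  split => [->|/eqP]; first by apply/matrixP => i j; rewrite !mxE; ring.
  by rewrite !subr_eq => /eqP ->; apply/matrixP => i j; rewrite !mxE; ring.
split=> [H|[Hb Hz] t t0 x]; last first.
  apply/gE/matrixP => i j.
  have gd s : is_derive s (1 : R) (fun s => g x s i j)
      ((zeta (X s x) - zeta x) i j).
    have := (is_derive_mxP _ _ _).1 (straightened_derive x s) i j.
    by rewrite Hb.
  have [c /andP[c0 _] E] := MVT_real gd t0.
  by apply/eqP; rewrite -subr_eq0 E Hz// subrr mxE mul0r.
have Hb t x : 0 <= t -> (1%:M - jac Phi (X t x)) *m b (X t x) = zeta x.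
  move=> t0; apply/eqP; rewrite -subr_eq0; apply/eqP/matrixP => i j.
  rewrite [RHS]mxE.
  have gd := (is_derive_mxP _ _ _).1 (straightened_derive x t) i j.
  apply: right_cst_derive gd _ => s ts.
  by rewrite [LHS](congr1 (fun M : 'cV_d => M i j) ((gE x s).1 (H s (le_trans t0 ts) x)))
    (congr1 (fun M : 'cV_d => M i j) ((gE x t).1 (H t t0 x))).
have Hb0 x : (1%:M - jac Phi x) *m b x = zeta x.
  by have := Hb 0 x (lexx _); rewrite (flow0 hX).
by split=> // t t0 x; rewrite -(Hb t x t0) Hb0.
Qed.

End equivalence.

Section torus.
Context {R : realType} {d : nat}.
Local Open Scope quotient_scope.
Implicit Types x y : 'cV[R]_d.

Local Notation T := (torus R d).

Lemma torus_piP x y :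
  \pi_T x = \pi_T y <-> exists k : 'cV[int]_d, y = x + map_mx intr k.
Proof.
split; first by move=> /eqmodP /asboolP.
by move=> H; apply/eqmodP/asboolP.
Qed.

Lemma torus_pi_surj (y : T) : exists x, y = \pi_T x.
Proof. by exists (repr y); rewrite reprK. Qed.

Lemma repr_pi x : exists k : 'cV[int]_d, repr (\pi_T x) = x + map_mx intr k.
Proof. by apply/torus_piP; rewrite reprK. Qed.

Lemma on_torus_pi (W : Type) (f : 'cV[R]_d -> W) x :
  (forall x (k : 'cV[int]_d), f (x + map_mx intr k) = f x) ->
  f (repr (\pi_T x)) = f x.
Proof. by move=> pf; have [k ->] := repr_pi x. Qed.

Lemma torus_continuous (W : topologicalType) (f : 'cV[R]_d -> W) :
  continuous f ->
  (forall x (k : 'cV[int]_d), f (x + map_mx intr k) = f x) ->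
  continuous (fun y : T => f (repr y)).
Proof.
move=> cf pf; apply/quotient_continuous.
have -> : (fun y : T => f (repr y)) \o \pi_T = f; last exact: cf.
by apply/funext => x; exact: on_torus_pi.
Qed.

Lemma torus_compact : compact [set: T].
Proof.
suff -> : [set: T] = \pi_T @` unit_cube.
  apply: continuous_compact unit_cube_compact.
  by apply: continuous_subspaceT; exact: pi_continuous.
apply/esym; rewrite -subTset => y _; have [x ->] := torus_pi_surj y.
have [k xk] := unit_cube_rep x; exists (x + map_mx intr k) => //.
by apply/esym/torus_piP; exists k.
Qed.

Lemma torus_pi_open (A : set 'cV[R]_d) : open A -> open (\pi_T @` A).
Proof.
move=> oA; rewrite /open /= /quotient_open.
have -> : \pi_T @^-1` (\pi_T @` A) =
    \bigcup_(k in [set: 'cV[int]_d]) ((fun z => z + map_mx intr k) @^-1` A).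
  apply/seteqP; split => [z [a Aa /esym/torus_piP[k E]]|z [k _ Ak]].
    by exists k => //; rewrite /preimage /= -E.
  by exists (z + map_mx intr k) => //; apply/esym/torus_piP; exists k.
apply: bigcup_open => k _; apply: open_comp => // z _.
by apply: continuousD => //; exact: cst_continuous.
Qed.

(** If [y - x] is not an integer vector, some entry [y i 0 - x i 0] has a
    fractional part [r] in ]0, 1[. Balls of radius at most [r / 2] and
    [(1 - r) / 2] around [x] and [y] stay disjoint after all integer
    translations. *)
Lemma torus_hausdorff : hausdorff_space T.
Proof.
rewrite open_hausdorff => p q; have [x ->] := torus_pi_surj p.
have [y ->] := torus_pi_surj q => xy.
have [i iP] : exists i, forall m : int, y i 0 - x i 0 != m%:~R.
  apply: contrapT => /forallNP H; move/eqP: xy; apply; apply/torus_piP.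
  have /choice[k kP] : forall i, exists m : int, y i 0 - x i 0 = m%:~R.
    by move=> i; have /existsNP[m /negP/negPn/eqP E] := H i; exists m.
  exists (\col_i k i); apply/matrixP => i j; rewrite (ord1 j) !mxE -kP; ring.
pose u := y i 0 - x i 0; pose m := Num.floor u; pose r := u - m%:~R.
have r0 : 0 < r.
  rewrite subr_gt0 lt_neqAle eq_sym iP /=; exact: floor_le_tmp.
have r1 : r < 1 by have := lt_succ_floor u; rewrite intrD /r /m /=; lra.
pose e := Num.min r (1 - r) / 2.
have e0 : 0 < e by rewrite divr_gt0// lt_min r0 subr_gt0.
exists (\pi_T @` ball x e, \pi_T @` ball y e).
  by split; apply/mem_set; [exists x|exists y] => //; exact: ballxx.
split; [exact/torus_pi_open/ball_open|exact/torus_pi_open/ball_open|].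
apply/eqP/seteqP; split => // z [[v xv <-] [w yw]] /torus_piP[k E].
move: xv yw; rewrite -!ball_normE /= => xv yw.
have {}xv := le_lt_trans (mx_entry_le _ i 0) xv.
have {}yw := le_lt_trans (mx_entry_le _ i 0) yw.
move: xv yw; rewrite E !mxE !ltr_norml.
have e1 : 2 * e <= r by rewrite /e mulrC divfK// ge_min lexx.
have e2 : 2 * e <= 1 - r by rewrite /e mulrC divfK// ge_min lexx orbT.
have rn : y i 0 - x i 0 = r + m%:~R by rewrite /r subrK.
move=> /andP[h1 h2] /andP[h3 h4].
have [n0|n0] := leP 0 (m + k i 0).
  have : 0 <= (m + k i 0)%:~R :> R by rewrite ler0z.
  rewrite intrD; lra.
have : (m + k i 0)%:~R <= (-1)%:~R :> R by rewrite ler_int; lia.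
rewrite intrD; lra.
Qed.

Lemma torus_measurable_fun (f : T -> R) : continuous f ->
  measurable_fun setT (f : borel_torus R d -> R).
Proof.
move=> /continuousP cf; apply: (measurability _ (@RGenOpens.measurableE R)).
move=> _ [_ [a [c ->]] <-]; rewrite setTI; apply: sub_sigma_algebra.
exact/cf/interval_open.
Qed.

Section torus_flow.
Variables (b : 'cV[R]_d -> 'cV[R]_d) (X : R -> 'cV[R]_d -> 'cV[R]_d).
Hypotheses (hb : C1_per b) (hX : is_flow b X).

Lemma torus_flow_pi t x : torus_flow X t (\pi_T x) = \pi_T (X t x).
Proof.
rewrite /torus_flow; have [k ->] := repr_pi x.
by rewrite (flow_translate hb hX); apply/esym/torus_piP; exists k.
Qed.

Lemma torus_flow_continuous t : continuous (torus_flow X t).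
Proof.
apply/quotient_continuous.
have -> : torus_flow X t \o \pi_T = \pi_T \o X t.
  by apply/funext => x; exact: torus_flow_pi.
move=> x; apply: continuous_comp; first exact: flow_continuous hb hX t x.
exact: pi_continuous.
Qed.

Lemma torus_flowK t (y : T) : torus_flow X (- t) (torus_flow X t y) = y.
Proof.
by have [x ->] := torus_pi_surj y; rewrite !torus_flow_pi (flowK hb hX).
Qed.

Lemma torus_flow_measurable t :
  measurable_fun setT (torus_flow X t : borel_torus R d -> borel_torus R d).
Proof.
apply: (@measurability _ _ (borel_torus R d) (borel_torus R d) setT _ (@open T)) => //.
move=> _ [A oA <-]; rewrite setTI; apply: sub_sigma_algebra.
by have /continuousP := @torus_flow_continuous t; apply.
Qed.

Lemma on_torus_invariantP (f : 'cV[R]_d -> 'cV[R]_d) : Zd_periodic f ->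
  (forall t, 0 <= t -> on_torus f \o torus_flow X t = on_torus f) <->
  (forall t, 0 <= t -> forall x, f (X t x) = f x).
Proof.
move=> pf; split=> [H t t0 x|H t t0].
  have := congr1 (@^~ (\pi_T x)) (H t t0).
  by rewrite /= torus_flow_pi /on_torus !on_torus_pi.
apply/funext => y; have [x ->] := torus_pi_surj y.
by rewrite /= torus_flow_pi /on_torus !on_torus_pi// H.
Qed.

End torus_flow.

End torus.

(** * Measures on the Cantor space *)

(** A copy of the Cantor space, which carries the algebra of its clopen sets
    rather than a sigma-algebra. *)
Definition clopen_cantor : Type := cantor_space.

HB.instance Definition _ := Pointed.on clopen_cantor.
HB.instance Definition _ := isAlgebraOfSets.Build default_measure_display
  clopen_cantor (@clopen0 cantor_space) (@clopenU cantor_space)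
  (fun A => @clopenC cantor_space A A).

Definition cantor_sigma : measurableType _ :=
  g_sigma_algebraType (@measurable _ clopen_cantor).

Section clopen_measure.
Context {R : realType}.
Variable L : set cantor_space -> R.
Hypotheses (L0 : L set0 = 0) (Lge0 : forall A, 0 <= L A)
  (LU : forall A B, A `&` B = set0 -> L (A `|` B) = L A + L B).

Let content_bigsetU (F : (set cantor_space)^nat) n : trivIset setT F ->
  L (\big[setU/set0]_(i < n) F i) = \sum_(i < n) L (F i).
Proof.
move=> tF; elim: n => [|n IHn]; first by rewrite !big_ord0.
rewrite !big_ord_recr /= LU ?IHn//.
apply/seteqP; split => // x [] /=; rewrite -bigcup_mkord => -[i /= ilt Fi] Fn.
by move: ilt; rewrite (tF i n)// ?ltnn//; exists x.
Qed.

(** When a clopen set is a disjoint union of clopen sets, compactness shows that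
    all but finitely many are empty; so additivity on clopen sets is countable
    additivity, and the extension theorem for measures applies. *)
Lemma clopen_measure : exists nu : {measure set cantor_sigma -> \bar R},
  forall A : set cantor_space, clopen A -> nu A = (L A)%:E.
Proof.
pose m (A : set clopen_cantor) : \bar R := (L A)%:E.
have m0 : m set0 = 0%E by rewrite /m L0.
have mge0 A : (0 <= m A)%E by rewrite lee_fin.
have msigma : semi_sigma_additive m.
  move=> F mF tF mUF.
  have cU : compact (\bigcup_n F n : set cantor_space).
    by apply: (subclosed_compact mUF.2 cantor_space_compact).
  have cover : \forall n \near \oo, \bigcup_n F n `<=` [set x | (\bigcup_(i < n) F i) x].
    move/compact_near_coveringP : cU; apply => x [i _ Fix].
    have Fnx : nbhs (x : cantor_space) (F i).
      by apply: open_nbhs_nbhs; split => //; case: (mF i).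
    exists (F i, [set n | (i < n)%N]).
      by split => //=; exists i.+1.
    by move=> [y n] [/= Fiy ilt]; exists i.
  apply: cvg_near_cst; near=> n.
  rewrite big_mkord /m sumEFin -content_bigsetU//; congr ((L _)%:E).
  rewrite -bigcup_mkord; apply/seteqP; split.
    by move=> x [i _ Fix]; exists i.
  by near: n.
pose mu : {measure set clopen_cantor -> \bar R} :=
  HB.pack m (isMeasure.Build _ _ _ m m0 mge0 msigma).
exists (measure_extension mu) => A cA.
exact: (@measurable_mu_extE _ R clopen_cantor mu A cA).
Unshelve. all: by end_near. Qed.

End clopen_measure.

Section cantor_clopens.

Lemma cantor_clopen_nbhs (x : cantor_space) (U : set cantor_space) :
  open U -> U x -> exists V, [/\ clopen V, V x & V `<=` U].
Proof.
move=> oU Ux; have xU : nbhs x U by apply: open_nbhs_nbhs.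
have := @zero_dimensional_cvg cantor_space x cantor_space_hausdorff cantor_zero_dimensional
  cantor_space_compact.
by move=> /(_ U xU)[V [Vx cV] VU]; exists V.
Qed.

Definition cantor_pmetric (R : realType) : pseudoPMetricType R :=
  HB.pack cantor_space (PseudoMetric.class (cantor_space : pseudoMetricType R)).

(** Clopen sets form a basis, and there are countably many of them since the
    Cantor space is compact and metrizable. In particular open sets are
    measurable for the sigma-algebra generated by clopen sets. *)
Lemma cantor_open_clopens (R : realType) (U : set cantor_space) : open U ->
  exists B : (set cantor_space)^nat,
    [/\ forall n, clopen (B n), nondecreasing_seq B & \bigcup_n B n = U].
Proof.
move=> oU.
have cc := clopen_countable cantor_space_compact
  (@compact_second_countable R (cantor_pmetric R) cantor_space_compact).
have /pfcard_geP[C0|[f]] : countable (@clopen cantor_space `&` [set V | V `<=` U]).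
- by apply: sub_countable cc; exact: subset_card_le.
- by have : set0 (@set0 cantor_space) by rewrite -C0; split => //; exact: clopen0.
pose B n := \big[setU/set0]_(i < n.+1) f i.
have fc i : clopen (f i) /\ f i `<=` U by have := @funS _ _ _ _ f i I.
exists B; split.
- move=> n; rewrite /B; elim/big_ind : _; [exact: clopen0|exact: clopenU|].
  by move=> i _; exact: (fc i).1.
- by move=> m n mn; apply/subsetPset; apply: subset_bigsetU.
- rewrite /B bigcup_bigsetU_bigcup.
  apply/seteqP; split => [x [n _] fx|x Ux]; first exact: (fc n).2.
  have [V [cV Vx VU]] := cantor_clopen_nbhs oU Ux.
  by have [n _ fn] := @surj _ _ _ _ f V (conj cV VU); exists n => //; rewrite fn.
Qed.

Lemma cantor_clopen_between (R : realType) (K U : set cantor_space) : closed K -> open U ->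
  K `<=` U -> exists V, [/\ clopen V, K `<=` V & V `<=` U].
Proof.
move=> cK oU KU; have [B [cB ndB BU]] := cantor_open_clopens R oU.
have : compact K by exact: subclosed_compact cK cantor_space_compact _.
move=> /compact_near_coveringP /(_ nat \oo (fun n x => B n x) _).
case=> [x /KU|N _ /(_ N (leqnn _)) KN].
  rewrite -BU => -[i _ Bix]; exists (B i, [set n | (i <= n)%N]).
    split => /=; last by exists i.
    by apply: open_nbhs_nbhs; split => //; case: (cB i).
  by move=> [y n] [/= Biy ile]; have /subsetPset := ndB _ _ ile; exact.
by exists (B N); split => //; rewrite -BU; exact: bigcup_sup.
Qed.

End cantor_clopens.

(** * Asymptotic frequencies *)

Lemma ultra_fmap (T U : Type) (f : T -> U) (F : set_system T) :
  UltraFilter F -> UltraFilter (f @ F).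
Proof.
move=> FU; split=> [|G PG FG]; first exact: fmap_proper_filter.
rewrite predeqE => A; split=> [GA|]; last exact: FG.
have [//|nA] := in_ultra_setVsetC (f @^-1` A) FU.
have /filter_ex[x [Ax nAx]] : G (A `&` ~` A) by apply: filterI => //; exact: FG.
by [].
Qed.

Section cantor_torus.
Context {R : realType} {d : nat}.
Local Open Scope quotient_scope.
Local Notation T := (torus R d).

Lemma set_type_compact (U : topologicalType) (A : set U) :
  compact A -> compact [set: A].
Proof.
rewrite !compact_ultra /= => cA F FU _.
have FA : (set_val @ F) A.
  by rewrite /fmap /=; apply: (filterS _ filterT) => x _; exact: set_valP.
have [p [Ap Fp]] := cA _ (ultra_fmap _ FU) FA.
exists (SigSub (mem_set Ap)); split => // V.
rewrite /= nbhsE => -[B [[W oW <-] Wp] BV].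
apply: (filterS BV); apply: Fp; exact: open_nbhs_nbhs.
Qed.

Lemma set_type_hausdorff (U : topologicalType) (A : set U) :
  hausdorff_space U -> hausdorff_space A.
Proof.
move=> hU p q pq; apply: val_inj; apply: hU => V W Vp Wq.
have [|x [Vx Wx]] := pq (set_val @^-1` V) (set_val @^-1` W) (initial_continuous Vp).
  exact: initial_continuous Wq.
by exists (set_val x).
Qed.

Let zero_cube : unit_cube (0 : 'cV[R]_d).
Proof. by move=> i; rewrite mxE lexx ler01. Qed.

(** By the Alexandroff-Hausdorff theorem the Cantor space maps onto the compact
    metric space [unit_cube], which in turn maps onto the torus. *)
Lemma cantor_torus_surj : exists2 f : cantor_space -> T, continuous f &
  forall y, exists z, f z = y.
Proof.
pose C : Type := set_type (@unit_cube R d).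
pose CP : pseudoPMetricType R := HB.pack C
  (PseudoMetric.class (set_type (@unit_cube R d) : pseudoMetricType R))
  (isPointed.Build C (SigSub (mem_set zero_cube))).
have [||f cf] := @cantor_surj R CP.
- exact: (set_type_compact unit_cube_compact).
- apply: set_type_hausdorff; exact: norm_hausdorff.
exists (fun z => \pi_T (set_val (f z))).
  move=> z; apply: (@continuous_comp _ CP _ f (fun c : CP => \pi_T (set_val c))).
    exact: cf.
  apply: (@continuous_comp CP _ _ (set_val : C -> _)); last exact: pi_continuous.
  exact: initial_continuous.
move=> y; have [x ->] := torus_pi_surj y.
have [k xk] := unit_cube_rep x.
have [z _ fz] := @surj _ _ _ _ f (SigSub (mem_set xk)) I.
exists z; rewrite fz /=; apply/esym/torus_piP; exists k => //.
Qed.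

End cantor_torus.

Section ultra_mean.
Context {R : realType}.

(** A shift by one drops one term of the sum and adds another one. *)
Lemma sum_shift_le (g : int -> R) (M : nat) (m : int) :
  (forall k, 0 <= g k <= 1) ->
  \sum_(i < M) g (i%:Z + m) <= \sum_(i < M) g i%:Z + `|m|%N%:R.
Proof.
move=> g01.
have shift1 (h : int -> R) : (forall k, 0 <= h k <= 1) ->
    `|\sum_(i < M) h (i%:Z + 1) - \sum_(i < M) h i%:Z| <= 1.
  move=> h01.
  have : h 0 + \sum_(i < M) h (i%:Z + 1) = \sum_(i < M) h i%:Z + h M%:Z.
    rewrite -(big_ord_recr M (fun i => h i%:Z)) big_ord_recl; congr (_ + _).
    by apply: eq_bigr => i _; rewrite lift0 -addn1 PoszD.
  by move=> E; have := h01 0; have := h01 M%:Z; rewrite ler_norml; lra.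
elim/int_ind: m g g01 => [g g01|n IHn g g01|n IHn g g01].
- by rewrite absz0 addr0; under eq_bigr do rewrite addr0.
- rewrite absz_nat -natr1 addrA.
  apply: (le_trans (y := \sum_(i < M) g (i%:Z + 1) + n%:R)).
    have := IHn (fun k => g (k + 1)) (fun k => g01 (k + 1)).
    rewrite absz_nat; apply: le_trans; rewrite le_eqVlt; apply/orP; left.
    by apply/eqP/eq_bigr => i _; congr g; lia.
  by have := shift1 g g01; rewrite ler_norml; lra.
- rewrite abszN absz_nat -natr1 addrA.
  apply: (le_trans (y := \sum_(i < M) g (i%:Z - 1) + n%:R)).
    have := IHn (fun k => g (k - 1)) (fun k => g01 (k - 1)).
    rewrite abszN absz_nat; apply: le_trans; rewrite le_eqVlt; apply/orP; left.
    by apply/eqP/eq_bigr => i _; congr g; lia.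
  have := shift1 (fun k => g (k - 1)) (fun k => g01 (k - 1)).
  under eq_bigr do rewrite addrK.
  by rewrite ler_norml; lra.
Qed.

Variables (T : Type) (o : R -> T).

(** Proportion of visits to [S] at the times [i / (n + 1)] for
    [i < (n + 1) ^ 2]: the mesh tends to zero and the horizon to infinity, so
    that in the limit any real shift of time is an integral shift of the index
    which is negligible with respect to the number of samples. *)
Let freq (n : nat) (S : set T) : R :=
  (\sum_(i < n.+1 ^ 2) \1_S (o (i%:R / n.+1%:R))) / (n.+1 ^ 2)%:R.

Let freq01 n S : 0 <= freq n S <= 1.
Proof.
have N0 : 0 < (n.+1 ^ 2)%:R :> R by rewrite ltr0n expn_gt0.
rewrite /freq divr_ge0 ?sumr_ge0//= ler_pdivrMr// mul1r.
rewrite -[in leRHS](card_ord (n.+1 ^ 2)) -sumr_const; apply: ler_sum => i _.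
by rewrite indicE lern1 leq_b1.
Qed.

Let freqU n A B : A `&` B = set0 -> freq n (A `|` B) = freq n A + freq n B.
Proof.
move=> AB0; rewrite /freq -mulrDl -big_split /=; congr (_ / _).
apply: eq_bigr => i _; rewrite !indicE in_setU.
have [/set_mem Ai|_] := boolP (_ \in A); last by rewrite add0r.
have [/set_mem Bi|_] := boolP (_ \in B); last by rewrite addr0.
by have : (A `&` B) (o (i%:R / n.+1%:R)) by []; rewrite AB0.
Qed.

Let freq_shift (S S' : set T) (t e : R) : 0 < e ->
  (forall r s, 0 <= r -> `|s - t| < e -> S' (o r) -> S (o (r + s))) ->
  \forall n \near \oo, freq n S' <= freq n S + (`|t| + 1) * (n.+1%:R)^-1.
Proof.
move=> e0 SS'; near=> n.
have N0 : 0 < n.+1%:R :> R by rewrite ltr0n.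
have M0 : 0 < (n.+1 ^ 2)%:R :> R by rewrite ltr0n expn_gt0.
pose m := Num.floor (t * n.+1%:R).
pose g (k : int) : R := \1_S (o (k%:~R / n.+1%:R)).
have g01 k : 0 <= g k <= 1 by rewrite /g indicE ler0n lern1 leq_b1.
have m1 : m%:~R <= t * n.+1%:R := floor_le_tmp _.
have m2 : t * n.+1%:R < m%:~R + 1 by have := lt_succ_floor (t * n.+1%:R); rewrite intrD.
have mt : `|m%:~R / n.+1%:R - t| < e.
  apply: (@le_lt_trans _ _ (n.+1%:R)^-1); last first.
    by near: n; exact: near_infty_natSinv_lt (PosNum e0).
  rewrite -[t in leLHS](mulfK (lt0r_neq0 N0)) -mulrBl normrM normfV (gtr0_norm N0).
  by rewrite ler_piMl ?invr_ge0 ?(ltW N0)// ler_norml; lra.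
have h1 : \sum_(i < n.+1 ^ 2) \1_S' (o (i%:R / n.+1%:R)) <=
    \sum_(i < n.+1 ^ 2) g (i%:Z + m).
  apply: ler_sum => i _; rewrite /g intrD mulrDl !indicE ler_nat.
  case: (boolP (_ \in S')) => // /set_mem iS'.
  by rewrite mem_set//; apply: SS' => //; rewrite divr_ge0.
have h2 := le_trans h1 (sum_shift_le _ _ g01).
rewrite /freq ler_pdivrMr// mulrDl divfK ?gt_eqF//.
apply: (le_trans h2); rewrite lerD2l natr_absz.
rewrite natrX expr2 mulrA divfK ?gt_eqF// intr_norm.
rewrite mulrDl mul1r -[in leRHS](gtr0_norm N0) -normrM.
rewrite (gtr0_norm N0).
have N1 : 1 <= n.+1%:R :> R by rewrite ler1n.
have := ler_norm (t * n.+1%:R); have := ler_norm (- (t * n.+1%:R)); rewrite normrN.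
by move=> h3 h4; rewrite ler_norml; lra.
Unshelve. all: by end_near. Qed.

(** The limit of [freq] along an ultrafilter exists for every set [A], so [L] is
    additive on all sets, measurable or not. The last property is what remains
    of invariance under a shift of time by [t]: a shift by exactly [t] is not
    available, as it is rounded to a multiple of the mesh. *)
Lemma ultra_mean : exists L : set T -> R,
  [/\ L set0 = 0, forall A, 0 <= L A,
      forall A B, A `&` B = set0 -> L (A `|` B) = L A + L B,
      forall A, (forall s, 0 <= s -> A (o s)) -> L A = 1 &
      forall (A B : set T) (t e : R), 0 < e ->
        (forall r s, 0 <= r -> `|s - t| < e -> B (o r) -> A (o (r + s))) ->
        L B <= L A].
Proof.
have [G [GU ooG]] := ultraFilterLemma (@eventually_filter).
have Gcvg S : cvg (freq n S @[n --> G]).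
  have := @segment_compact R 0 1; rewrite compact_ultra /=.
  move=> /(_ _ (ultra_fmap (freq ^~ S) GU))[|l [_ fl]]; last exact: cvgP fl.
  by apply: (@filterS _ G _ setT _ _ filterT) => n _ /=; rewrite in_itv /= freq01.
pose L S := lim (freq n S @[n --> G]).
exists L; split.
- apply/cvg_lim => //; apply: cvg_near_cst; apply: (filterS _ filterT) => n _.
  by rewrite /freq big1 ?mul0r// => i _; rewrite indic0.
- move=> A; apply: limr_ge => //; apply: (filterS _ filterT) => n _.
  by have /andP[] := freq01 n A.
- move=> A B AB; apply/cvg_lim => //.
  under eq_fun do rewrite freqU//.
  exact: cvgD.
- move=> A Ao; apply/cvg_lim => //; apply: cvg_near_cst; apply: (filterS _ filterT) => n _.
  rewrite /freq (eq_bigr (fun=> 1)); last first.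
    by move=> i _; rewrite indicE mem_set//; apply: Ao; rewrite divr_ge0.
  by rewrite sumr_const card_ord divff// pnatr_eq0 expn_eq0.
- move=> A B t e e0 AB.
  have c0 : (`|t| + 1) * (n.+1%:R)^-1 @[n --> G] --> (0 : R).
    apply: (cvg_trans (cvg_app _ ooG)).
    rewrite -(mulr0 (`|t| + 1)); apply: cvgMr.
    exact: cvg_harmonic.
  rewrite -[L A]addr0 -(cvg_lim (@Rhausdorff R) c0) -limD//; last exact: cvgP c0.
  apply: ler_lim; [exact: Gcvg|by apply: is_cvgD => //; exact: cvgP c0|].
  by apply: ooG; exact: freq_shift e0 AB.
Qed.

End ultra_mean.

(** * Invariant probability measures *)

(* A pushforward is a measure only together with a proof that the map is
   measurable, which is the last argument here. *)
Local Notation image_measure :=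
  measure_function_pushforward__canonical__measure_function_Measure.

Section krylov_bogoliubov.
Context {R : realType} {d : nat}.
Variables (b : 'cV[R]_d -> 'cV[R]_d) (X : R -> 'cV[R]_d -> 'cV[R]_d).
Hypotheses (hb : C1_per b) (hX : is_flow b X).
Local Open Scope quotient_scope.
Local Notation T := (torus R d).

(** Joint continuity of the flow in time and space. *)
Lemma torus_flow_near (O : set T) (t : R) (y : T) :
  open O -> O (torus_flow X t y) ->
  exists U e, [/\ open U, U y, 0 < e &
    forall y' s, U y' -> `|s - t| < e -> O (torus_flow X s y')].
Proof.
have [x ->] := torus_pi_surj y; rewrite (torus_flow_pi hb hX) => oO Ox.
have [B B0 XB] := flow_speed hb hX.
have : nbhs (X t x) (\pi_T @^-1` O).
  by apply: open_nbhs_nbhs; split => //; have /continuousP := @pi_continuous _ T; exact.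
move=> /nbhs_ballP[e /= e0 eO].
have e20 : 0 < e / 2 by rewrite divr_gt0.
pose A := X t @^-1` (ball (X t x) (e / 2)).
have oA : open A.
  by have /continuousP := @flow_continuous _ _ _ _ hb hX t; apply; exact: ball_open.
exists (\pi_T @` A), (e / 2 / (B + 1)).
have B10 : 0 < B + 1 by rewrite ltr_wpDl.
split.
- exact: torus_pi_open.
- by exists x => //; exact: ballxx.
- by rewrite divr_gt0.
- move=> _ s [z Az <-] st; rewrite (torus_flow_pi hb hX); apply: eO.
  rewrite [e]splitr; apply: ball_triangle Az _.
  rewrite -ball_normE /= distrC; apply: le_lt_trans (XB _ _ _) _.
  rewrite ltr_pdivlMr// in st; apply: le_lt_trans st.
  by rewrite mulrC ler_wpM2l// lerDl.
Qed.

Lemma torus_flowD s t (y : T) : torus_flow X (s + t) y = torus_flow X s (torus_flow X t y).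
Proof.
by have [x ->] := torus_pi_surj y; rewrite !(torus_flow_pi hb hX) (flowD hb hX).
Qed.

(** The room needed to move the time [t] a little, uniformly over a
    neighbourhood of the compact set [K]. *)
Lemma open_preimage_thicken (K O : set T) (t : R) : closed K -> open O ->
  K `<=` torus_flow X t @^-1` O ->
  exists U e, [/\ open U, K `<=` U, 0 < e &
    forall y s, U y -> `|s - t| < e -> O (torus_flow X s y)].
Proof.
move=> cK oO KO.
pose Q e := interior [set y | forall s, `|s - t| < e -> O (torus_flow X s y)].
have : compact K by exact: subclosed_compact cK torus_compact _.
move=> /compact_near_coveringP /(_ R 0^'+ (fun e y => Q e y) _).
case=> [y /KO /= Oy|e0 /= e00 HQ].
  have [U [e [oU Uy e0 UO]]] := torus_flow_near oO Oy.
  exists (U, [set r | r < e]).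
    by split => /=; [exact: open_nbhs_nbhs|exact: nbhs_right_lt].
  move=> [y' r] [/= Uy' re]; rewrite /Q /= /interior.
  apply: filterS (open_nbhs_nbhs (conj oU Uy')) => z Uz s sr.
  by apply: UO => //; exact: lt_trans sr re.
have e20 : 0 < e0 / 2 by rewrite divr_gt0.
exists (Q (e0 / 2)), (e0 / 2); split => //; first exact: open_interior.
  apply: HQ => //=; rewrite sub0r normrN gtr0_norm// ltr_pdivrMr// mulr_natr mulr2n.
  by rewrite ltrDl.
by move=> y s /interior_subset; exact.
Qed.

(** Let [L] be the frequencies of visits of the orbit of [y0], and [c] a section
    of a continuous surjection [f] from the Cantor space onto the torus. The
    measure [nu] extends [L] transported by [c] to the clopen sets, and [mu] is
    its image by [f]. For a closed set [K], [mu K] is the infimum of [nu V] for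
    [V] clopen around the preimage of [K]. Such a [V] contains the preimage of an
    open set [O] around [K], and the shift property of [L], applied to [O] and to
    a thickening of the preimage of [K] by the flow, bounds the measure of that
    preimage by [nu V]. Applying this to [t] and [- t] gives equality on closed
    sets, hence on the Borel sets. *)
Theorem krylov_bogoliubov (y0 : T) :
  exists2 mu : probability (borel_torus R d) R, flow_invariant X mu &
    forall A : set T, closed A -> (forall s, 0 <= s -> A (torus_flow X s y0)) ->
      mu A = 1%E.
Proof.
have [L [L0 Lge0 LU L1 Lshift]] := ultra_mean (fun s => torus_flow X s y0).
have {}Lshift (A B : set T) t e : 0 < e ->
    (forall y s, B y -> `|s - t| < e -> A (torus_flow X s y)) -> L B <= L A.
  move=> e0 H; apply: (Lshift _ _ t e e0) => r s r0 st Br.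
  by rewrite addrC torus_flowD; exact: H.
have Lle A B : A `<=` B -> L A <= L B.
  by move=> AB; rewrite -(setDUK AB) LU ?lerDl// setDIK.
have [f cf fsurj] := @cantor_torus_surj R d.
have [c fc] : exists c : T -> cantor_space, forall y, f (c y) = y.
  by have /choice[c cE] := fsurj; exists c.
pose L' (A : set cantor_space) := L (c @^-1` A).
have [|nu nuE] := @clopen_measure R L' L0 (fun A => Lge0 _).
  move=> A B AB; rewrite /L' preimage_setU LU// -preimage_setI AB.
  exact: preimage_set0.
have clopen_meas (A : set cantor_space) : clopen A -> measurable (A : set cantor_sigma).
  by move=> cA; exact: sub_sigma_algebra.
have open_meas (A : set cantor_space) : open A -> measurable (A : set cantor_sigma).
  move=> /(cantor_open_clopens R)[B [cB _ <-]].
  by apply: bigcupT_measurable => n; exact: clopen_meas (cB n).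
have f_open (A : set T) : open A -> open (f @^-1` A).
  by move=> oA; have /continuousP := cf; exact.
have mf : measurable_fun setT (f : cantor_sigma -> borel_torus R d).
  apply: (@measurability _ _ cantor_sigma (borel_torus R d) setT _ (@open T)) => //.
  by move=> _ [A oA <-]; rewrite setTI; apply: open_meas; exact: f_open.
pose m : {measure set (borel_torus R d) -> \bar R} :=
  image_measure nu mf.
have m1 : m setT = 1%E.
  by rewrite /m /= /pushforward preimage_setT nuE /L' ?preimage_setT ?L1//; exact: clopenT.
pose mu : probability (borel_torus R d) R := HB.pack (m : set _ -> _)
  (Measure.class m) (Measure_isProbability.Build _ _ _ m m1).
have muE A : mu A = nu (f @^-1` A) by [].
have closed_meas (K : set T) : closed K -> measurable (K : set (borel_torus R d)).
  move=> cK; rewrite -[K]setCK; apply: measurableC; apply: sub_sigma_algebra.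
  exact: closed_openC.
have muC (A : set T) : measurable (A : set (borel_torus R d)) -> mu (~` A) = (1 - mu A)%E.
  exact: probability_setC.
have mu_le (K : set T) t : closed K -> (mu (torus_flow X t @^-1` K) <= mu K)%E.
  move=> cK; set Kt := torus_flow X t @^-1` K.
  have flowC := @torus_flow_continuous _ _ _ _ hb hX t.
  have cKt : closed Kt by apply: preimage_closed.
  have fK_closed (K' : set T) : closed K' -> closed (f @^-1` K').
    by move=> ?; apply: preimage_closed.
  (* [f z] in [O] forces [z] in [V], and [O] is open because [f] is closed. *)
  have step (V : set cantor_space) : clopen V -> f @^-1` K `<=` V -> (mu Kt <= (L' V)%:E)%E.
    move=> cV KV; pose O := ~` (f @` ~` V).
    have oO : open O.
      apply: closed_openC; apply: compact_closed; first exact: torus_hausdorff.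
      apply: continuous_compact; first exact: continuous_subspaceT.
      apply: subclosed_compact cantor_space_compact _ => //.
      exact: (clopenC set0 cV).2.
    have KO : K `<=` O by move=> y Ky [z nVz fz]; apply: nVz; apply: KV; rewrite /= fz.
    have [U [e [oU KtU e0 UO]]] := open_preimage_thicken cKt oO (fun y Ky => KO _ Ky).
    have [W [cW KW WU]] := cantor_clopen_between R (fK_closed _ cKt) (f_open _ oU)
      (fun z Kz => KtU _ Kz).
    apply: (@le_trans _ _ (nu W)).
      rewrite muE; apply: le_measure => //; rewrite inE; last exact: clopen_meas.
      by rewrite -[X in measurable X]setTI; exact: (mf measurableT _ (closed_meas _ cKt)).
    rewrite nuE// lee_fin /L'; apply: (@le_trans _ _ (L U)).
      by apply: Lle => y /WU /=; rewrite fc.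
    apply: (@le_trans _ _ (L O)); first exact: Lshift e0 UO.
    apply: Lle => y Oy /=; apply: contrapT => nV; apply: Oy.
    by exists (c y).
  have [B [cB ndB BE]] := cantor_open_clopens R (closed_openC (fK_closed _ cK)).
  have [p muK] : exists p, mu K = p%:E.
    by exists (fine (mu K)); rewrite fineK// fin_num_measure//; exact: closed_meas.
  have [q muKt] : exists q, mu Kt = q%:E.
    by exists (fine (mu Kt)); rewrite fineK// fin_num_measure//; exact: closed_meas.
  have : (mu (~` K) <= 1 - mu Kt)%E.
    rewrite (muE (~` K)) (_ : f @^-1` (~` K) = \bigcup_n B n); last by rewrite BE.
    have cvB := nondecreasing_cvg_mu (mu := nu) (fun n => clopen_meas _ (cB n))
      (bigcupT_measurable _ (fun n => clopen_meas _ (cB n))) ndB.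
    apply: (cvge_to_le cvB); apply: nearW => n.
    rewrite [X in (X <= _)%E]/= nuE// muKt -EFinB lee_fin.
    have : (mu Kt <= (L' (~` B n))%:E)%E.
      apply: step; first exact: (clopenC set0 (cB n)).
      by move=> z Kz Bz; have : (\bigcup_n B n) z by [exists n]; rewrite BE.
    have := LU (c @^-1` B n) (c @^-1` (~` B n)).
    rewrite -preimage_setI setICr preimage_set0 -preimage_setU setUv preimage_setT L1//.
    by rewrite muKt lee_fin /L' => /(_ erefl); lra.
  rewrite muC; last exact: closed_meas.
  by rewrite muK muKt -!EFinB !lee_fin; lra.
(* The other inequality is [mu_le] at time [- t] for the closed set
   [torus_flow X t @^-1` K], whose preimage at that time is [K]. *)
have mu_eq (K : set T) t : closed K -> mu (torus_flow X t @^-1` K) = mu K.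
  move=> cK; apply/eqP; rewrite eq_le mu_le//=.
  have : closed (torus_flow X t @^-1` K).
    apply: preimage_closed => // y _; exact: (torus_flow_continuous hb hX).
  move=> /(mu_le _ (- t)); congr (_ <= _)%E; congr (mu _); apply/seteqP.
  by split => y /=; have := torus_flowK hb hX (- t) y; rewrite opprK => ->.
exists mu.
  move=> t _ A mA.
  pose mut : {measure set (borel_torus R d) -> \bar R} :=
    image_measure mu
      (torus_flow_measurable hb hX t).
  apply: (@measure_unique _ R (borel_torus R d) (@open T) (fun=> setT) _ _ _ _ mut mu) => //.
  - exact: openI.
  - by move=> _; exact: openT.
  - by rewrite bigcup_const.
  - move=> W oW; rewrite -[W]setCK; have cO := open_closedC oW.
    have mO := closed_meas _ cO.
    have mtO : measurable (torus_flow X t @^-1` (~` W) : set (borel_torus R d)).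
      have := torus_flow_measurable hb hX t; move=> /(_ measurableT _ mO).
      by rewrite setTI.
    have -> : mut (~` ~` W) = mu (~` (torus_flow X t @^-1` (~` W))).
      by rewrite /mut /= /pushforward preimage_setC.
    by rewrite (muC _ mtO) mu_eq//; exact/esym/(muC _ mO).
  - move=> _; apply: (@le_lt_trans _ _ 1%E); last exact: ltry.
    rewrite /mut /= /pushforward preimage_setT; exact: (probability_le1 mu measurableT).
move=> A cA oA; rewrite -[A]setCK muC; last first.
  by apply: measurableC; exact: closed_meas.
suff -> : mu (~` A) = 0%E by rewrite sube0.
have [B [cB ndB BE]] := cantor_open_clopens R (f_open _ (closed_openC cA)).
apply/eqP; rewrite eq_le measure_ge0 andbT muE.
rewrite (_ : f @^-1` (~` A) = \bigcup_n B n); last by rewrite BE.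
have cvB := nondecreasing_cvg_mu (mu := nu) (fun n => clopen_meas _ (cB n))
  (bigcupT_measurable _ (fun n => clopen_meas _ (cB n))) ndB.
apply: (cvge_to_le cvB); apply: nearW => n /=.
rewrite nuE// lee_fin /L'; apply: (@le_trans _ _ (L (~` A))).
  apply: Lle => y /= Bcy; have : (\bigcup_n B n) (c y) by [exists n].
  by rewrite BE /= fc.
have := LU _ _ (setICr A); rewrite setUv L1// (L1 A)//; lra.

Qed.

End krylov_bogoliubov.

(** * Rotation vectors of invariant measures *)

Section torus_mean.
Context {R : realType} {d : nat}.
Local Notation T := (torus R d).
Variable mu : probability (borel_torus R d) R.

Definition periodic_continuous (f : 'cV[R]_d -> R) : Prop :=
  continuous f /\ forall x (k : 'cV[int]_d), f (x + map_mx intr k) = f x.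

Definition torus_mean (f : 'cV[R]_d -> R) : R :=
  (\int[mu]_y f (repr (y : T)))%R.

Lemma torus_periodic_continuous f :
  periodic_continuous f -> continuous (fun y : T => f (repr y)).
Proof. by move=> [cf pf]; exact: torus_continuous. Qed.

Lemma periodic_continuous_integrable f : periodic_continuous f ->
  mu.-integrable [set: borel_torus R d] (EFin \o (fun y : T => f (repr y))).
Proof.
move=> cpf; apply: measurable_bounded_integrable => //.
- exact: (le_lt_trans (probability_le1 mu measurableT) (ltry 1)).
- exact: (torus_measurable_fun (torus_periodic_continuous cpf)).
case: cpf => cf pf; have [B fB] := periodic_bounded cf pf.
by exists B; split; [exact: num_real|move=> x Bx y _; exact: le_trans (fB _) (ltW Bx)].
Qed.

Lemma periodic_continuousD f g : periodic_continuous f ->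
  periodic_continuous g -> periodic_continuous (fun x => f x + g x).
Proof.
by move=> [cf pf] [cg pg]; split=> [x|x k]; [exact: continuousD (cf x) (cg x)|rewrite pf pg].
Qed.

Lemma periodic_continuousZ (a : R) f :
  periodic_continuous f -> periodic_continuous (fun x => a * f x).
Proof.
move=> [cf pf]; split=> [x|x k]; last by rewrite pf.
by apply: (@continuousM _ _ (cst a) f x); [exact: cst_continuous|exact: cf].
Qed.

Lemma periodic_continuous_entry (f : 'cV[R]_d -> 'cV[R]_d) i : continuous f -> Zd_periodic f ->
  periodic_continuous (fun x => f x i 0).
Proof.
move=> cf pf; split=> [x|x k]; last by rewrite pf.
exact: continuous_entry cf x.
Qed.

Lemma torus_meanD f g : periodic_continuous f -> periodic_continuous g ->
  torus_mean (fun x => f x + g x) = torus_mean f + torus_mean g.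
Proof. by move=> cf cg; apply: RintegralD => //; exact: periodic_continuous_integrable. Qed.

Lemma torus_meanZ a f : periodic_continuous f ->
  torus_mean (fun x => a * f x) = a * torus_mean f.
Proof. by move=> cf; apply: RintegralZl => //; exact: periodic_continuous_integrable. Qed.

Lemma torus_mean_norm_le f M : periodic_continuous f ->
  (forall x, `|f x| <= M) -> `|torus_mean f| <= M.
Proof.
move=> cf fM; have fi := periodic_continuous_integrable cf.
rewrite /torus_mean /Rintegral.
have fin : (\int[mu]_y (f (repr (y : T)))%:E \is a fin_num)%E by exact: integrable_fin_num fi.
rewrite -lee_fin -abse_EFin fineK//.
apply: le_trans (le_abse_integral mu measurableT (measurable_int _ fi)) _.
apply: (@le_trans _ _ (\int[mu]_y (cst M%:E) y)%E).
  apply: ge0_le_integral => //; last by move=> y _; rewrite lee_fin; exact: fM.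
  apply/measurable_EFinP; apply: measurableT_comp => //.
  exact: (torus_measurable_fun (torus_periodic_continuous cf)).
by rewrite integral_cst// [X in (_ * X)%E]probability_setT mule1.
Qed.

Lemma torus_mean_ge0 f : (forall x, 0 <= f x) -> 0 <= torus_mean f.
Proof. by move=> f0; apply: Rintegral_ge0 => y _; exact: f0. Qed.

Lemma torus_mean_cst a : torus_mean (fun=> a) = a.
Proof. by rewrite /torus_mean Rintegral_cst// [X in fine X]probability_setT mulr1. Qed.

End torus_mean.

Section rotation_vector.
Context {R : realType} {d : nat}.
Local Notation T := (torus R d).
Variables (b : 'cV[R]_d -> 'cV[R]_d) (X : R -> 'cV[R]_d -> 'cV[R]_d).
Hypotheses (hb : C1_per b) (hX : is_flow b X).

Lemma periodic_continuous_flow t f : periodic_continuous f -> periodic_continuous (f \o X t).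
Proof.
move=> [cf pf]; split=> [x|x k]; last by rewrite /= (flow_translate hb hX) pf.
by apply: continuous_comp; [exact: flow_continuous hb hX t x|exact: cf].
Qed.

(** The function [f \o X t] is again periodic and its values on the torus are
    those of [f] composed with the flow, so this is a change of variable. *)
Lemma torus_mean_flow (mu : probability (borel_torus R d) R) f t :
  flow_invariant X mu -> 0 <= t -> periodic_continuous f ->
  torus_mean mu (f \o X t) = torus_mean mu f.
Proof.
move=> inv t0 cf; rewrite /torus_mean /Rintegral; congr fine.
have fi := periodic_continuous_integrable mu cf.
pose g (y : borel_torus R d) : \bar R := (f (repr (y : T)))%:E.
pose mut : {measure set (borel_torus R d) -> \bar R} :=
  image_measure mu
    (torus_flow_measurable hb hX t).
have mutE A : measurable A -> mut A = mu A by move=> mA; exact: inv.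
transitivity (\int[mut]_y g y)%E; last first.
  by apply: eq_measure_integral => A mA _; exact: mutE.
have flow_repr y : f (repr (torus_flow X t y)) = f (X t (repr y)).
  by rewrite /torus_flow on_torus_pi//; case: cf.
rewrite /mut /= (integral_pushforward (torus_flow_measurable hb hX t))//; last 2 first.
- by apply/measurable_EFinP; exact: (torus_measurable_fun (torus_periodic_continuous cf)).
- have := periodic_continuous_integrable mu (periodic_continuous_flow t cf).
  rewrite preimage_setT.
  apply: eq_integrable => // y _ /=; congr (_%:E); exact/esym/flow_repr.
by rewrite preimage_setT; apply: eq_integral => y _ /=; rewrite /g flow_repr.
Qed.

(** The velocity [b (X s x)] differs from [b x] by at most [L * B * s]. *)
Lemma flow_taylor : exists2 K, 0 <= K &
  forall h x, 0 <= h -> `|X h x - x - h *: b x| <= K * h ^+ 2.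
Proof.
have [B B0 XB] := flow_speed hb hX; have [L L0 bL] := C1_per_lipschitz hb.
exists (L * B) => [|h x h0]; first exact: mulr_ge0.
apply: mx_norm_le => [|i j]; first by rewrite !mulr_ge0.
have dX s : is_derive s (1 : R) (fun s => X s x i j - x i j - s * b x i j)
    ((b (X s x) - b x) i j).
  have dXi := (is_derive_mxP _ _ _).1 (flow_derive hX x s) i j.
  have -> : (fun s => X s x i j - x i j - s * b x i j) =
    (fun s => X s x i j) - cst (x i j) - (fun s => s * b x i j) by apply/funext.
  apply: is_derive_eq; rewrite !mxE /GRing.scale /=; ring.
have [c /andP[c0 ch]] := MVT_real dX h0.
rewrite mul0r (flow0 hX) !subr0 subrr subr0 !mxE => ->.
rewrite normrM (ger0_norm h0) expr2 !mulrA ler_wpM2r//.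
have := mx_entry_le (b (X c x) - b x) i j; rewrite !mxE => /le_trans; apply.
apply: (le_trans (bL _ _)); rewrite -mulrA ler_wpM2l//.
have := XB 0 c x; rewrite (flow0 hX) subr0 (ger0_norm c0) => /le_trans; apply.
by rewrite ler_wpM2l.
Qed.

(** The mean [g t] of [th t] is additive in [t] because [zeta] and [mu] are
    invariant, and it is bounded; so it is zero. By [flow_taylor], the
    difference of the two means is then at most [K * h] for all [h > 0]. *)
Lemma rotation_vectorE (zeta : 'cV[R]_d -> 'cV[R]_d) (C : R)
    (mu : probability (borel_torus R d) R) i :
  continuous zeta -> Zd_periodic zeta ->
  (forall t, 0 <= t -> forall x, zeta (X t x) = zeta x) ->
  (forall t, 0 <= t -> forall x, `|X t x - x - t *: zeta x| <= C) ->
  flow_invariant X mu ->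
  torus_mean mu (fun x => b x i 0) = torus_mean mu (fun x => zeta x i 0).
Proof.
move=> cz pz iz zC inv.
pose th t x := (X t x - x - t *: zeta x) i 0.
have cth t : periodic_continuous (th t).
  apply: (periodic_continuous_entry (f := fun x => X t x - x - t *: zeta x)) => [x|x k].
    apply: (@continuousB _ _ _ (fun y => X t y - y) (fun y => t *: zeta y) x).
      apply: (@continuousB _ _ _ (X t) id x) => //; exact: flow_continuous hb hX t x.
    by apply: (@continuousZr _ _ _ _ t x); exact: cz.
  by rewrite (flow_translate hb hX) pz; congr (_ - _); rewrite opprD addrACA subrr addr0.
have thC t x : 0 <= t -> `|th t x| <= C.
  by move=> t0; exact: le_trans (mx_entry_le _ _ _) (zC t t0 x).
pose g t := torus_mean mu (th t).
have gD t s : 0 <= t -> 0 <= s -> g (t + s) = g t + g s.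
  move=> t0 s0; rewrite -[g t](torus_mean_flow inv s0 (cth t)) /g -torus_meanD//.
    congr (torus_mean mu _); apply/funext => x /=.
    by rewrite /th (flowD hb hX) iz// !mxE; ring.
  exact: periodic_continuous_flow.
have gM n t : 0 <= t -> g (n%:R * t) = n%:R * g t.
  move=> t0; elim: n => [|n IHn]; last by rewrite -natr1 !mulrDl !mul1r gD ?IHn ?mulr_ge0.
  have := gD 0 0 (lexx _) (lexx _); rewrite !mul0r addr0; lra.
have g0 t : 0 <= t -> g t = 0.
  move=> t0; apply/eqP; rewrite -normr_eq0 eq_le normr_ge0 andbT leNgt; apply/negP => gt0.
  (* Otherwise [n.+1 * t] is a time at which the mean exceeds the bound [C]. *)
  pose n := Num.truncn (C / `|g t|).
  have : C < n.+1%:R * `|g t| by rewrite -ltr_pdivrMr// real_truncnS_gt// num_real.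
  apply/negP; rewrite -leNgt -[n.+1%:R]ger0_norm// -normrM -gM//.
  by apply: torus_mean_norm_le => [|x]; [exact: cth|rewrite thC// mulr_ge0].
have [K K0 XK] := flow_taylor.
set D1 := torus_mean _ _; set D2 := torus_mean _ _.
have cb : periodic_continuous (fun x => b x i 0).
  by apply: periodic_continuous_entry; [exact: C1_per_continuous|case: hb].
have cz' : periodic_continuous (fun x => zeta x i 0) by exact: periodic_continuous_entry.
have DK h : 0 < h -> `|D1 - D2| <= K * h.
  move=> h0; rewrite -(ler_pM2l h0) mulrCA -expr2.
  rewrite -{1}(gtr0_norm h0) -normrM.
  have -> : h * (D1 - D2) =
      - torus_mean mu (fun x => (th h x + (- h) * b x i 0) + h * zeta x i 0).
    rewrite torus_meanD ?torus_meanD ?torus_meanZ//;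
      do ?[exact: cth|exact: periodic_continuousZ|apply: periodic_continuousD].
    by rewrite -/(g h) g0 ?ltW// -/D1 -/D2; ring.
  rewrite normrN; apply: torus_mean_norm_le => [|x].
    by do ?[exact: periodic_continuousZ|exact: cth|apply: periodic_continuousD].
  apply: le_trans (XK h x (ltW h0)).
  have := mx_entry_le (X h x - x - h *: b x) i 0; apply: le_trans.
  by rewrite /th !mxE le_eqVlt; apply/orP; left; apply/eqP; congr `|_|; ring.
apply/eqP; rewrite -subr_eq0 -normr_eq0 eq_le normr_ge0 andbT leNgt; apply/negP => D0.
have K1 : 0 < K + 1 by rewrite ltr_wpDl.
have := DK (`|D1 - D2| / (2 * (K + 1))) (divr_gt0 D0 (mulr_gt0 (ltr0Sn _ 1) K1)).
have -> : K * (`|D1 - D2| / (2 * (K + 1))) = `|D1 - D2| * (K / (2 * (K + 1))) by ring.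
have : K / (2 * (K + 1)) < 1 by rewrite ltr_pdivrMr ?mulr_gt0//; lra.
by rewrite -(ltr_pM2l D0) mulr1 => /lt_le_trans/[apply]; rewrite ltxx.
Qed.

End rotation_vector.

(** * Barycenters and convex hulls *)

Section caratheodory.
Context {R : realType} {d : nat}.
Local Notation V := 'cV[R]_d.

Definition convex_weights n (l : 'I_n -> R) : Prop :=
  (forall i, 0 <= l i) /\ \sum_i l i = 1.

(** The [d + 2] rows [(v i, 1)] of length [d + 1] are linearly dependent. *)
Lemma affine_dependence (v : 'I_d.+2 -> V) : exists u : 'I_d.+2 -> R,
  [/\ \sum_i u i = 0, \sum_i u i *: v i = 0 & exists i, 0 < u i].
Proof.
pose A : 'M[R]_(d.+2, d + 1) := \matrix_i row_mx (v i)^T 1%:M.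
have : kermx A != 0.
  rewrite kermx_eq0 /row_free neq_ltn; apply/orP; left.
  by apply: (leq_ltn_trans (rank_leq_col A)); rewrite addn1.
move=> /rowV0Pn[w /sub_kermxP wA w0].
have wAE : \sum_i w 0 i *: row i A = 0 by rewrite -mulmx_sum_row.
have rowA i : row i A = row_mx (v i)^T 1%:M by rewrite rowK.
have sv : \sum_i w 0 i *: v i = 0.
  have := congr1 lsubmx wAE; rewrite linear_sum linear0 /= => E.
  apply/trmx_inj; rewrite linear_sum /= trmx0 -[RHS]E; apply: eq_bigr => i _.
  by rewrite rowA linearZ /= linearZ /= row_mxKl.
have s1 : \sum_i w 0 i = 0.
  have := congr1 rsubmx wAE; rewrite linear_sum linear0 /= => /matrixP/(_ 0 0).
  rewrite summxE [RHS]mxE => E; rewrite -[RHS]E; apply: eq_bigr => i _.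
  by rewrite rowA linearZ /= row_mxKr !mxE eqxx mulr1.
have [i wi] : exists i, w 0 i != 0.
  apply: contrapT => /forallNP H; move/eqP: w0; apply; apply/rowP => i.
  by rewrite mxE; have /negP/negPn/eqP := H i.
have [wi0|wi0] := ltP 0 (w 0 i).
  by exists (fun i => w 0 i); split => //; exists i.
exists (fun i => - w 0 i); split.
- by rewrite sumrN s1 oppr0.
- under eq_bigr do rewrite scaleNr.
  by rewrite sumrN sv oppr0.
- by exists i; rewrite oppr_gt0 lt_neqAle wi.
Qed.

(** Subtracting from the weights [l] the largest multiple of an affine
    dependence which keeps them nonnegative makes one of them vanish. *)
Lemma caratheodory (v : 'I_d.+2 -> V) l : convex_weights l ->
  exists (j : 'I_d.+2) (m : 'I_d.+1 -> R), convex_weights m /\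
    \sum_i m i *: v (lift j i) = \sum_i l i *: v i.
Proof.
move=> [l0 l1]; have [u [su suv [i0 ui0]]] := affine_dependence v.
pose j := [arg min_(i < i0 | 0 < u i) (l i / u i)]%O.
have [uj jmin] : 0 < u j /\ forall i, 0 < u i -> l j / u j <= l i / u i.
  by rewrite /j; case: arg_minP => // k uk kmin; split => // i /kmin.
pose m i := l i - l j / u j * u i.
have m0 i : 0 <= m i.
  rewrite subr_ge0; have [ui|ui] := ltP 0 (u i).
    by rewrite -ler_pdivlMr// jmin.
  by apply: le_trans (l0 i); rewrite mulr_ge0_le0// divr_ge0// ltW.
have mj : m j = 0 by rewrite /m divfK ?subrr// gt_eqF.
have m1 : \sum_i m i = 1 by rewrite /m sumrB -mulr_sumr su mulr0 subr0.
have mv : \sum_i m i *: v i = \sum_i l i *: v i.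
  rewrite /m; under eq_bigr do rewrite scalerBl -scalerA.
  by rewrite sumrB -scaler_sumr suv scaler0 subr0.
exists j, (fun i => m (lift j i)); split.
  by split=> //; rewrite -m1 (bigD1_ord j)//= mj add0r.
by rewrite -mv (bigD1_ord j)//= mj scale0r add0r.
Qed.

Lemma convex_setP (C : set V) : @convex_set R V C <->
  forall x y t, C x -> C y -> 0 <= t <= 1 -> C (t *: x + (1 - t) *: y).
Proof.
split=> [H x y t Cx Cy /andP[t0 t1]|H x y t xC yC].
  by have := H x y (Itv01 t0 t1) (mem_set Cx) (mem_set Cy) => /set_mem.
by apply/mem_set/H; [exact: set_mem|exact: set_mem|rewrite ge0 le1].
Qed.

Lemma convex_set_sum (C : set V) n (l : 'I_n -> R) (v : 'I_n -> V) :
  @convex_set R V C -> convex_weights l -> (forall i, C (v i)) ->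
  C (\sum_i l i *: v i).
Proof.
move=> /convex_setP hC; elim: n => [|n IHn] in l v *.
  by move=> [_]; rewrite big_ord0 => /eqP; rewrite eq_sym oner_eq0.
move=> [l0 l1] vC; rewrite big_ord_recl; move: l1; rewrite big_ord_recl => l1.
have [s0|s0] := eqVneq (\sum_(i < n) l (lift ord0 i)) 0.
  have li0 i : l (lift ord0 i) = 0.
    by apply/eqP; move/eqP: s0; rewrite psumr_eq0// => /allP/(_ i); apply;
      rewrite mem_index_enum.
  rewrite big1 ?addr0; last by move=> i _; rewrite li0 scale0r.
  by move: l1; rewrite s0 addr0 => ->; rewrite scale1r.
have sE : \sum_(i < n) l (lift ord0 i) = 1 - l ord0 by rewrite -l1 addrC addKr.
rewrite sE in s0.
have -> : \sum_(i < n) l (lift ord0 i) *: v (lift ord0 i) =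
    (1 - l ord0) *: \sum_(i < n) (l (lift ord0 i) / (1 - l ord0)) *: v (lift ord0 i).
  by rewrite scaler_sumr; apply: eq_bigr => i _; rewrite scalerA mulrC divfK.
have s_ge0 : 0 <= 1 - l ord0 by rewrite -sE sumr_ge0.
apply: hC => //; last by rewrite l0 -subr_ge0.
apply: IHn => //; split=> [i|]; first by rewrite divr_ge0.
by rewrite -mulr_suml sE divff.
Qed.

End caratheodory.

Section barycenter.
Context {R : realType} {d : nat}.
Local Notation V := 'cV[R]_d.
Variable f : V -> V.
Hypotheses (cf : continuous f) (pf : Zd_periodic f).

Let comb (p : 'rV[R]_d.+1 * 'M[R]_(d.+1, d)) : V :=
  \sum_i p.1 0 i *: f (row i p.2)^T.

(** Weights and base points of the combinations of [d + 1] values of [f]; base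
    points in the unit cube suffice, by periodicity. *)
Let S : set ('rV[R]_d.+1 * 'M[R]_(d.+1, d)) :=
  ([set l : 'rV[R]_d.+1 | forall i j, 0 <= l i j <= 1] `&`
    [set l : 'rV[R]_d.+1 | \sum_i l 0 i = 1])
  `*` [set q : 'M[R]_(d.+1, d) | forall i j, 0 <= q i j <= 1].

Let S_compact : compact S.
Proof.
apply: compact_setX; last exact: box_compact.
apply: compact_closedI; first exact: box_compact.
apply: (@preimage_closed _ R (fun l : 'rV[R]_d.+1 => \sum_i l 0 i) [set 1]).
  move=> l _; apply: continuous_bigsum => i; exact: coord_continuous.
exact: closed_eq.
Qed.

Let comb_continuous j : continuous (fun p => comb p j 0).
Proof.
have -> : (fun p => comb p j 0) = (fun p => \sum_i p.1 0 i * f (row i p.2)^T j 0).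
  by apply/funext => p; rewrite summxE; apply: eq_bigr => i _; rewrite mxE.
apply: continuous_bigsum => i p.
apply: (@continuousM R ('rV[R]_d.+1 * 'M[R]_(d.+1, d))%type
    (fun p => p.1 0 i) (fun p => f (row i p.2)^T j 0) p).
  apply: (@continuous_comp _ _ _ fst (fun l : 'rV[R]_d.+1 => l 0 i) p).
    exact: cvg_fst.
  exact: coord_continuous.
apply: (@continuous_comp _ _ _ snd (fun q : 'M[R]_(d.+1, d) => f (row i q)^T j 0) p).
  exact: cvg_snd.
apply: (@continuous_comp _ _ _ (fun q : 'M[R]_(d.+1, d) => (row i q)^T) (fun x => f x j 0)).
  apply: mx_continuousP => k l q.
  under eq_fun do rewrite !mxE.
  exact: coord_continuous.
exact: (periodic_continuous_entry j cf pf).1.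
Qed.

Let comb_weights (l : 'I_d.+1 -> R) (x : 'I_d.+1 -> V) : convex_weights l ->
  exists2 p, S p & comb p = \sum_i l i *: f (x i).
Proof.
move=> [l0 l1].
have /choice[k kP] : forall i, exists k : 'cV[int]_d, unit_cube (x i + map_mx intr k).
  by move=> i; exact: unit_cube_rep.
exists (\row_i l i, \matrix_i (x i + map_mx intr (k i))^T).
  split; last by move=> i j; have := kP i j; rewrite !mxE.
  split=> [i j|]; last by rewrite /= -l1; apply: eq_bigr => i _; rewrite mxE.
  by rewrite !mxE l0 /= -l1 (bigD1 j)//= lerDl sumr_ge0.
apply: eq_bigr => i _; congr (_ *: _); first by rewrite mxE.
by rewrite /= rowK trmxK pf.
Qed.

Let S_weights p : S p -> convex_weights (fun i => p.1 0 i).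
Proof. by move=> [[l01 l1] _]; split=> // i; have /andP[] := l01 0 i. Qed.

(** A combination of [d + 1] values of [f] nearest to [m] in the euclidean norm
    exists by compactness. Moving it towards a value [f x] produces a combination
    of [d + 2] values, which [caratheodory] brings back to [d + 1] values; so it
    is not nearer to [m], and to first order this is the inequality. *)
Let nearest (m : V) : exists2 p, S p &
  forall x, \sum_j (m j 0 - comb p j 0) * (f x j 0 - comb p j 0) <= 0.
Proof.
pose dist p := \sum_j (m j 0 - comb p j 0) ^+ 2.
have S0 : S !=set0.
  have [|p Sp _] := @comb_weights (fun i => (i == 0)%:R) (fun=> 0); last by exists p.
  by split=> // ; rewrite (bigD1 ord0)//= big1 ?addr0// => i /negPf ->.
have [|p] := @compact_EVT_min _ _ dist S S0 S_compact.
  apply: continuous_subspaceT; apply: continuous_bigsum => j p.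
  apply: (@continuous_comp _ _ _ (fun p => m j 0 - comb p j 0) (fun r : R => r ^+ 2)).
    apply: (@continuousB _ _ _ (fun=> m j 0) (fun p => comb p j 0) p).
      exact: cst_continuous.
    exact: comb_continuous.
  exact: exprn_continuous.
rewrite inE => Sp pmin; exists p => // x.
set h := comb p.
have hull t : 0 <= t <= 1 -> exists2 p', S p' & comb p' = (1 - t) *: h + t *: f x.
  move=> /andP[t0 t1]; have [l0 l1] := S_weights Sp.
  (* The extra base point [x], with weight [t], is put in the last position. *)
  pose v i := if unlift (@ord_max d.+1) i is Some k then (row k p.2)^T else x.
  pose l i := if unlift (@ord_max d.+1) i is Some k then (1 - t) * p.1 0 k else t.
  have lw : convex_weights l.
    split=> [i|].
      by rewrite /l; case: unliftP => [k _|_] //; rewrite mulr_ge0// subr_ge0.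
    rewrite (bigD1_ord ord_max)//= /l unlift_none.
    under eq_bigr do rewrite liftK.
    by rewrite -mulr_sumr l1 mulr1 addrC subrK.
  have [j [m' [mw E]]] := caratheodory (f \o v) lw.
  have [p' Sp' pE] := @comb_weights m' (v \o lift j) mw.
  exists p' => //; rewrite pE E (bigD1_ord ord_max)//= /l /v unlift_none.
  under eq_bigr do rewrite liftK.
  by rewrite addrC scaler_sumr; congr (_ + _); apply: eq_bigr => i _; rewrite scalerA.
set a := \sum_j _.
pose q := \sum_j (f x j 0 - h j 0) ^+ 2.
have q0 : 0 <= q by apply: sumr_ge0 => j _; exact: sqr_ge0.
have key t : 0 <= t <= 1 -> 0 <= t ^+ 2 * q - 2 * t * a.
  move=> t01; have [p' /mem_set Sp' pE] := hull t t01.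
  have := pmin p' Sp'; rewrite -subr_ge0 /dist pE -sumrB /q /a !mulr_sumr -sumrB.
  move=> /le_trans; apply; rewrite le_eqVlt; apply/orP; left; apply/eqP.
  by apply: eq_bigr => j _; rewrite -/h !mxE; ring.
rewrite leNgt; apply/negP => a0.
(* A step with [t <= 1] and [t * q <= a]. *)
pose t := a / (q + a).
have qa : 0 < q + a by rewrite ltr_wpDl.
have t0 : 0 < t by rewrite divr_gt0.
have t1 : t <= 1 by rewrite ler_pdivrMr// mul1r lerDr.
have := key t; rewrite (ltW t0) t1 => /(_ isT).
have -> : t ^+ 2 * q - 2 * t * a = t * (t * q - 2 * a) by ring.
rewrite pmulr_rge0// => h1.
have tq : t * q <= a.
  by rewrite /t mulrAC ler_pdivrMr// ler_pM2l// lerDl ltW.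
lra.
Qed.

Lemma torus_mean_sum (mu : probability (borel_torus R d) R) n (g : 'I_n -> V -> R) :
  (forall i, periodic_continuous (g i)) ->
  periodic_continuous (fun x => \sum_i g i x) /\
  torus_mean mu (fun x => \sum_i g i x) = \sum_i torus_mean mu (g i).
Proof.
move=> cg; elim: n => [|n IHn] in g cg *.
  have -> : (fun x => \sum_(i < 0) g i x) = (fun=> 0) by apply/funext => x; rewrite big_ord0.
  by rewrite big_ord0 torus_mean_cst; split=> //; split=> // x; exact: cst_continuous.
have [c E] := IHn (fun i => g (widen_ord (leqnSn n) i)) (fun i => cg _).
have -> : (fun x => \sum_(i < n.+1) g i x) =
    (fun x => \sum_(i < n) g (widen_ord (leqnSn n) i) x + g ord_max x).
  by apply/funext => x; rewrite big_ord_recr.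
split; first exact: periodic_continuousD.
by rewrite torus_meanD// E big_ord_recr.
Qed.

(** Integrating the inequality of [nearest] for the mean [m] shows that the
    squared distance from [m] to the nearest combination is at most zero. *)
Lemma barycenter_conv_hull (mu : probability (borel_torus R d) R) :
  conv_hull (range f) (\col_i torus_mean mu (fun x => f x i 0)).
Proof.
set m := \col_i _; have [p Sp pmin] := nearest m.
have cfi i : periodic_continuous (fun x => f x i 0) by exact: periodic_continuous_entry.
have mE : m = comb p.
  pose a j := m j 0 - comb p j 0.
  pose g j x := a j * f x j 0 + - (a j * comb p j 0).
  have cg j : periodic_continuous (g j).
    apply: periodic_continuousD; first exact: periodic_continuousZ.
    by split=> // x; exact: cst_continuous.
  have [cs sE] := torus_mean_sum mu cg.
  have : \sum_j a j ^+ 2 <= 0.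
    have -> : \sum_j a j ^+ 2 = torus_mean mu (fun x => \sum_j g j x).
      rewrite sE; apply: eq_bigr => j _; rewrite /g torus_meanD.
      - by rewrite torus_meanZ// torus_mean_cst /a [m j 0]mxE; ring.
      - exact: periodic_continuousZ.
      - by split=> // x; exact: cst_continuous.
    rewrite -oppr_ge0 -mulN1r -torus_meanZ//; apply: torus_mean_ge0 => x.
    rewrite mulN1r oppr_ge0; apply: le_trans (pmin x).
    by rewrite le_eqVlt; apply/orP; left; apply/eqP/eq_bigr => j _; rewrite /g /a; ring.
  move=> s0; have {s0} : \sum_j a j ^+ 2 == 0.
    by rewrite eq_le s0 sumr_ge0// => j _; exact: sqr_ge0.
  rewrite psumr_eq0; last by move=> j _; exact: sqr_ge0.
  move=> /allP aj; apply/matrixP => j k; rewrite (ord1 k).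
  have := aj j (mem_index_enum _); rewrite /= sqrf_eq0 subr_eq0 => /eqP.
  by rewrite [m j 0]mxE.
move=> C [cC fC]; rewrite mE; apply: convex_set_sum => //; first exact: S_weights.
by move=> i; apply: fC; exists (row i p.2)^T.
Qed.

End barycenter.

Lemma conv_hull_convex (R : realType) (d : nat) (A : set 'cV[R]_d) :
  @convex_set R 'cV[R]_d A -> conv_hull A = A.
Proof.
move=> cA; apply/seteqP; split; first by apply: smallest_sub.
exact: sub_smallest.
Qed.

(** * The rotation set as a convex hull *)

Section mixture.
Context {R : realType} {d : nat}.
Local Notation T := (torus R d).

Lemma probability_mixture (mu nu : probability (borel_torus R d) R) (t : R) :
  0 <= t <= 1 -> exists rho : probability (borel_torus R d) R,
    (forall A, rho A = t%:E * mu A + (1 - t)%:E * nu A)%E /\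
    forall f, periodic_continuous f ->
      torus_mean rho f = t * torus_mean mu f + (1 - t) * torus_mean nu f.
Proof.
move=> /andP[t0 t1']; have t1 : 0 <= 1 - t by rewrite subr_ge0.
pose m : {measure set (borel_torus R d) -> \bar R} :=
  measure_add (mscale (NngNum t0) mu) (mscale (NngNum t1) nu).
have mE A : (m A = t%:E * mu A + (1 - t)%:E * nu A)%E.
  exact: (measure_addE (mscale (NngNum t0) mu) (mscale (NngNum t1) nu) A).
have m1 : m setT = 1%E.
  by rewrite mE !probability_setT !mule1 -EFinD addrC subrK.
pose rho : probability (borel_torus R d) R := HB.pack (m : set _ -> _)
  (Measure.class m) (Measure_isProbability.Build _ _ _ m m1).
exists rho; split; first exact: mE.
have rho_ge0 f : periodic_continuous f -> (forall x, 0 <= f x) ->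
    torus_mean rho f = t * torus_mean mu f + (1 - t) * torus_mean nu f.
  move=> cf f0; rewrite /torus_mean /Rintegral.
  have mf : measurable_fun setT (fun y : borel_torus R d => (f (repr (y : T)))%:E).
    by apply/measurable_EFinP; exact: (torus_measurable_fun (torus_periodic_continuous cf)).
  have f0' (y : borel_torus R d) : [set: borel_torus R d] y ->
      (0 <= (f (repr (y : T)))%:E)%E by move=> _; rewrite lee_fin.
  have fin (p : probability (borel_torus R d) R) :
      (\int[p]_y (f (repr (y : T)))%:E \is a fin_num)%E.
    exact: integrable_fin_num (periodic_continuous_integrable p cf).
  have -> : (\int[rho]_y (f (repr (y : T)))%:E =
      t%:E * \int[mu]_y (f (repr (y : T)))%:E +
      (1 - t)%:E * \int[nu]_y (f (repr (y : T)))%:E)%E.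
    by rewrite /rho /= /m ge0_integral_measure_add// !ge0_integral_mscale.
  by rewrite fineD ?fin_numM// !fineM.
(* Adding a constant to [f] makes it nonnegative, where integrals are additive
   in the measure without further conditions. *)
move=> f cf; have [cf' pf'] := cf; have [B fB] := periodic_bounded cf' pf'.
have cB : periodic_continuous (fun _ : 'cV[R]_d => B) by split=> // x; exact: cst_continuous.
have := rho_ge0 (fun x => f x + B) (periodic_continuousD cf cB).
rewrite !torus_meanD// !torus_mean_cst => E.
suff /E : forall x, 0 <= f x + B by lra.
by move=> x; have := fB x; rewrite ler_norml; lra.
Qed.

Lemma herman_rotation_set_convex (b : 'cV[R]_d -> 'cV[R]_d)
    (X : R -> 'cV[R]_d -> 'cV[R]_d) :
  continuous b -> Zd_periodic b ->
  @convex_set R 'cV[R]_d (herman_rotation_set b X).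
Proof.
move=> cb pb; apply/convex_setP => _ _ t [mu imu <-] [nu inu <-] t01.
have [rho [rhoE rho_mean]] := probability_mixture mu nu t01.
exists rho.
  by move=> s s0 A mA; rewrite !rhoE imu// inu.
apply/matrixP => i j; rewrite !mxE.
exact: rho_mean (periodic_continuous_entry i cb pb).
Qed.

End mixture.

Section rotation_set.
Context {R : realType} {d : nat}.
Local Notation T := (torus R d).
Variables (b zeta : 'cV[R]_d -> 'cV[R]_d) (X : R -> 'cV[R]_d -> 'cV[R]_d).
Hypotheses (hb : C1_per b) (hX : is_flow b X).
Hypotheses (cz : continuous zeta) (pz : Zd_periodic zeta).
Hypothesis iz : forall t, 0 <= t -> forall x, zeta (X t x) = zeta x.
Variable C : R.
Hypothesis zC : forall t, 0 <= t -> forall x, `|X t x - x - t *: zeta x| <= C.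

Lemma range_on_torus : range (on_torus zeta) = range zeta.
Proof.
apply/seteqP; split=> [_ [y _ <-]|_ [x _ <-]]; first by exists (repr y).
by exists (\pi_T%qT x) => //; exact: on_torus_pi.
Qed.

(** Every rotation vector is the mean of [zeta] for the same measure. *)
Lemma herman_rotation_set_sub : herman_rotation_set b X `<=` conv_hull (range zeta).
Proof.
move=> _ [mu imu <-].
rewrite [X in conv_hull _ X](_ : _ = \col_i torus_mean mu (fun x => zeta x i 0)).
  exact: barycenter_conv_hull.
apply/matrixP => i j; rewrite !mxE.
exact: (rotation_vectorE hb hX i cz pz iz zC imu).
Qed.

(** The level sets of the entries of [zeta] are closed and contain the orbit of
    each of their points, so the measure given by [krylov_bogoliubov] makes
    [zeta] almost everywhere constant. *)
Lemma range_sub_herman_rotation_set : range zeta `<=` herman_rotation_set b X.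
Proof.
move=> _ [x _ <-].
have [mu imu muA] := krylov_bogoliubov hb hX (\pi_T%qT x).
exists mu => //; apply/matrixP => i j; rewrite (ord1 j) mxE.
transitivity (torus_mean mu (fun x => zeta x i 0)).
  exact: (rotation_vectorE hb hX i cz pz iz zC imu).
have cT := torus_periodic_continuous (periodic_continuous_entry i cz pz).
pose A : set T := [set y | zeta (repr y) i 0 = zeta x i 0].
have cA : closed A.
  apply: (@preimage_closed _ R (fun y : T => zeta (repr y) i 0) [set zeta x i 0]).
    by move=> y _; exact: cT.
  exact: closed_eq.
have A1 : mu A = 1%E.
  apply: muA => // s s0; rewrite (torus_flow_pi hb hX) /A /=.
  by rewrite (@on_torus_pi _ _ _ zeta)// iz.
have mA : measurable (A : set (borel_torus R d)).
  rewrite -[A]setCK; apply: measurableC; apply: sub_sigma_algebra.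
  exact: closed_openC.
rewrite -[RHS](torus_mean_cst mu) /torus_mean /Rintegral; congr fine.
apply: ae_eq_integral => //.
- by apply/measurable_EFinP; exact: (torus_measurable_fun cT).
- apply: (@negligibleS _ _ _ mu (~` A)).
    by move=> y /= H Ay; apply: H => _; congr (_%:E).
  apply/negligibleP; first exact: measurableC.
  by apply: eq_trans (probability_setC mu mA) _; rewrite A1 subee.
Qed.

Lemma herman_rotation_setE : herman_rotation_set b X = conv_hull (range zeta).
Proof.
apply/seteqP; split; first exact: herman_rotation_set_sub.
apply: smallest_sub; last exact: range_sub_herman_rotation_set.
by apply: herman_rotation_set_convex; [exact: C1_per_continuous|case: hb].
Qed.

End rotation_set.

(** * The two-dimensional case *)

Section grid_parity.
Variables (p q : nat -> nat -> bool).

Let E (a b : nat * nat) : bool :=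
  [&& p a.1 a.2, p b.1 b.2 & q a.1 a.2 (+) q b.1 b.2].

(** The two-dimensional lemma of Sperner, on a square grid. A vertex has one of
    three labels: [~~ p], [p && q] or [p && ~~ q], and [E] marks the edges whose
    ends carry the last two. A triangle has an odd number of marked edges
    exactly when it carries the three labels. If no triangle does, the parity of
    the number of marked edges of a row does not depend on the row, since the
    lateral sides have no marked edge; but it is even at the bottom and odd at
    the top. *)
Lemma grid_trichromatic n :
  (forall j, (j <= n)%N -> ~~ q 0%N j) -> (forall j, (j <= n)%N -> q n j) ->
  (forall i, (i <= n)%N -> ~~ p i 0%N) -> (forall i, (i <= n)%N -> p i n) ->
  exists i j, [/\ (i < n)%N, (j < n)%N &
    exists A B C : bool * bool,
      let at_ (f : nat -> nat -> bool) (u : bool * bool) := f (i + u.1)%N (j + u.2)%N in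
      [/\ ~~ at_ p A, at_ p B && at_ q B & at_ p C && ~~ at_ q C]].
Proof.
move=> qL qR pB pT; apply: contrapT => no.
have triangle i j (u v w : bool * bool) : (i < n)%N -> (j < n)%N ->
    let at_ (u : bool * bool) := ((i + u.1)%N, (j + u.2)%N) in
    E (at_ u) (at_ v) (+) E (at_ v) (at_ w) (+) E (at_ w) (at_ u) = false.
  move=> ilt jlt /=; apply: contra_notF no => tri; exists i, j; split => //.
  move: tri; rewrite /E /=.
  case pu: (p (i + u.1)%N (j + u.2)%N); case pv: (p (i + v.1)%N (j + v.2)%N);
    case pw: (p (i + w.1)%N (j + w.2)%N) => //=; rewrite ?andbF //=;
  case qu: (q (i + u.1)%N (j + u.2)%N); case qv: (q (i + v.1)%N (j + v.2)%N);
    case qw: (q (i + w.1)%N (j + w.2)%N) => //= _;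
  (* One of the six orders of the vertices lists them as [A], [B], [C]. *)
  first [ by exists u, v, w; rewrite /= ?pu ?pv ?pw ?qu ?qv ?qw
        | by exists u, w, v; rewrite /= ?pu ?pv ?pw ?qu ?qv ?qw
        | by exists v, u, w; rewrite /= ?pu ?pv ?pw ?qu ?qv ?qw
        | by exists v, w, u; rewrite /= ?pu ?pv ?pw ?qu ?qv ?qw
        | by exists w, u, v; rewrite /= ?pu ?pv ?pw ?qu ?qv ?qw
        | by exists w, v, u; rewrite /= ?pu ?pv ?pw ?qu ?qv ?qw ].
pose H j i := \big[addb/false]_(k < i) E (k : nat, j) (k.+1, j).
have rowS j i : (j < n)%N -> (i <= n)%N ->
    H j.+1 i = H j i (+) E (0%N, j) (0%N, j.+1) (+) E (i, j) (i, j.+1).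
  move=> jlt; elim: i => [|i IHi] ile; first by rewrite /H !big_ord0 addFb addbb.
  rewrite /H !big_ord_recr /= -!/(H _ _) IHi; last exact: ltnW.
  have := triangle i j (false, false) (true, false) (true, true) ile jlt.
  have := triangle i j (false, false) (true, true) (false, true) ile jlt.
  rewrite /= !addn0 !addn1.
  have Esym a b : E a b = E b a by rewrite /E andbCA [q _ _ (+) _]addbC.
  rewrite (Esym (i.+1, j.+1) (i, j)) (Esym (i, j.+1) (i, j)) (Esym (i.+1, j.+1) (i, j.+1)).
  move: (E (i, j) (i.+1, j.+1)) (E (i, j.+1) (i.+1, j.+1)) (E (i, j) (i, j.+1))
    (E (i, j) (i.+1, j)) (E (i.+1, j) (i.+1, j.+1)) (H j i) (E (0%N, j) (0%N, j.+1)).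
  by do 7 case.
have H0 j : (j <= n)%N -> H j n = false.
  elim: j => [_|j IHj jlt].
    by rewrite /H big1// => k _; rewrite /E /= (negPf (pB k (ltnW (ltn_ord k)))).
  rewrite rowS// IHj; last exact: ltnW.
  rewrite /E /= (negPf (qL _ (ltnW jlt))) (negPf (qL _ jlt)) (qR _ (ltnW jlt)) (qR _ jlt).
  by rewrite !andbF.
have Hn i : (i <= n)%N -> H n i = q 0%N n (+) q i n.
  elim: i => [|i IHi] ile; first by rewrite /H big_ord0 addbb.
  rewrite /H big_ord_recr /= -/(H n i) IHi; last exact: ltnW.
  by rewrite /E /= !pT// ?(ltnW ile)//= -addbA addKb.
by have := H0 n (leqnn n); rewrite Hn// (negPf (qL n (leqnn n))) (qR n (leqnn n)).
Qed.

End grid_parity.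

(** On finer and finer grids, [grid_trichromatic] for the signs of [g1] and [g2]
    gives points where [`|g1| + `|g2|] is arbitrarily small: on a small triangle
    both functions change sign. The minimum of this sum over the square is then
    zero. *)
Lemma poincare_miranda (R : realType) (g1 g2 : R -> R -> R) (T K : R) :
  0 < T ->
  (forall s t s' t', `|g1 s t - g1 s' t'| <= K * (`|s - s'| + `|t - t'|)) ->
  (forall s t s' t', `|g2 s t - g2 s' t'| <= K * (`|s - s'| + `|t - t'|)) ->
  (forall t, `|t| <= T -> g1 (- T) t < 0) -> (forall t, `|t| <= T -> 0 < g1 T t) ->
  (forall s, `|s| <= T -> g2 s (- T) < 0) -> (forall s, `|s| <= T -> 0 < g2 s T) ->
  exists s t, g1 s t = 0 /\ g2 s t = 0.
Proof.
move=> T0 g1K g2K g1L g1R g2B g2T.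
have K0 : 0 <= K.
  have := g1K 1 0 0 0; rewrite subrr subr0 normr0 normr1 addr0 mulr1.
  exact: le_trans (normr_ge0 _).
have approx n : exists s t, [/\ `|s| <= T, `|t| <= T &
    `|g1 s t| + `|g2 s t| <= 8 * K * T * n.+1%:R^-1].
  have N0 : 0 < n.+1%:R :> R by rewrite ltr0n.
  pose x (i : nat) : R := - T + 2 * T * (i%:R / n.+1%:R).
  have xT i : (i <= n.+1)%N -> `|x i| <= T.
    move=> ile; have : 0 <= (i%:R / n.+1%:R : R) <= 1.
      by rewrite divr_ge0//= ler_pdivrMr// mul1r ler_nat.
    rewrite /x ler_norml; move: (i%:R / n.+1%:R : R) => r /andP[h1 h2].
    have := ler_wpM2l (ltW T0) h2; have := mulr_ge0 (ltW T0) h1; lra.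
  have x0 : x 0%N = - T by rewrite /x mul0r mulr0 addr0.
  have xn : x n.+1 = T by rewrite /x divff ?gt_eqF//; lra.
  have [|||| i [j [ilt jlt [A [B [C [/= hA hB hC]]]]]]] :=
    @grid_trichromatic (fun i j => 0 < g2 (x i) (x j)) (fun i j => 0 < g1 (x i) (x j)) n.+1.
  - by move=> j jn; rewrite x0 -leNgt ltW// g1L// xT.
  - by move=> j jn; rewrite xn g1R// xT.
  - by move=> j jn; rewrite x0 -leNgt ltW// g2B// xT.
  - by move=> j jn; rewrite xn g2T// xT.
  have close k (u v : bool) : `|x (k + u)%N - x (k + v)%N| <= 2 * T * n.+1%:R^-1.
    have -> : x (k + u)%N - x (k + v)%N = 2 * T * n.+1%:R^-1 * (u%:R - v%:R).
      by rewrite /x !natrD; ring.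
    have c0 : 0 <= 2 * T * n.+1%:R^-1 by rewrite !mulr_ge0 ?invr_ge0 ?ltW.
    rewrite normrM (ger0_norm c0) ler_piMr//.
    by case: u; case: v; rewrite /= ?subrr ?normr0 ?subr0 ?sub0r ?normrN ?normr1.
  exists (x (i + B.1)%N), (x (j + B.2)%N).
  have inT k (u : bool) : (k < n.+1)%N -> `|x (k + u)%N| <= T.
    by move=> klt; apply: xT; case: u; rewrite ?addn1 ?addn0// ltnW.
  split; [exact: inT|exact: inT|].
  have c1 := close i B.1 C.1; have c2 := close j B.2 C.2.
  have c3 := close i B.1 A.1; have c4 := close j B.2 A.2.
  have l1 := le_trans (g1K (x (i + B.1)%N) (x (j + B.2)%N) _ _) (ler_wpM2l K0 (lerD c1 c2)).
  have l2 := le_trans (g2K (x (i + B.1)%N) (x (j + B.2)%N) _ _) (ler_wpM2l K0 (lerD c3 c4)).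
  move: hA hB hC l1 l2; rewrite -!leNgt => hA /andP[hB1 hB2] /andP[_ hC].
  rewrite !ler_norml => /andP[_ l1] /andP[_ l2].
  rewrite (gtr0_norm hB1) (gtr0_norm hB2).
  move: l1 l2; move: (n.+1%:R^-1 : R) => r; lra.
pose S : set (R * R) := `[- T, T]%classic `*` `[- T, T]%classic.
have cS : compact S by apply: compact_setX; exact: segment_compact.
pose phi (z : R * R) := `|g1 z.1 z.2| + `|g2 z.1 z.2|.
have S0 : S !=set0 by exists (0, 0); split; rewrite /= in_itv /=; lra.
have phiK z z' : `|phi z - phi z'| <= 2 * K * (`|z.1 - z'.1| + `|z.2 - z'.2|).
  have h1 := g1K z.1 z.2 z'.1 z'.2; have h2 := g2K z.1 z.2 z'.1 z'.2.
  have h3 := le_trans (ler_dist_dist (g1 z.1 z.2) (g1 z'.1 z'.2)) h1.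
  have h4 := le_trans (ler_dist_dist (g2 z.1 z.2) (g2 z'.1 z'.2)) h2.
  move: h3 h4; rewrite /phi !ler_norml => h3 h4; lra.
have [|z] := @compact_EVT_min _ _ phi S S0 cS.
  apply: continuous_subspaceT => z.
  apply/(@cvgrPdist_le _ _ _ (nbhs z) (nbhs_filter z)) => e e0.
  pose dd := e / (4 * (K + 1)).
  have K1 : 0 < 4 * (K + 1) by lra.
  have dd0 : 0 < dd by rewrite divr_gt0.
  exists (ball z.1 dd, ball z.2 dd); first by split; exact: nbhsx_ballx.
  move=> [s t] [/= hs ht]; apply: le_trans (phiK _ _) _ => /=.
  move: hs ht; rewrite /ball /= => hs ht.
  have : dd * (4 * (K + 1)) = e by rewrite /dd divfK// gt_eqF.
  have := ler_wpM2l K0 (ltW hs); have := ler_wpM2l K0 (ltW ht); lra.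
rewrite inE => zS zmin; exists z.1, z.2.
suff : phi z <= 0.
  rewrite /phi => h; have h1 := normr_ge0 (g1 z.1 z.2); have h2 := normr_ge0 (g2 z.1 z.2).
  by split; apply/eqP; rewrite -normr_eq0; lra.
rewrite leNgt; apply/negP => phi0.
pose n := Num.truncn (8 * K * T / phi z).
have nlt : 8 * K * T < n.+1%:R * phi z by rewrite -ltr_pdivrMr// real_truncnS_gt// num_real.
have [s [t [sT tT st]]] := approx n.
have := zmin (s, t); rewrite inE /S /= !in_itv /= -!ler_norml sT tT => /(_ (conj isT isT)).
rewrite /phi /= -/(phi z) leNgt => /negP; apply.
by apply: le_lt_trans st _; rewrite ltr_pdivrMr// [X in _ < X]mulrC.
Qed.

Section planar.
Context {R : realType}.
Local Notation V := 'cV[R]_2.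
Variables (b zeta : V -> V) (X : R -> V -> V).
Hypotheses (hb : C1_per b) (hX : is_flow b X) (cz : continuous zeta).
Hypothesis iz : forall t, 0 <= t -> forall x, zeta (X t x) = zeta x.
Variable C : R.
Hypothesis zC : forall t, 0 <= t -> forall x, `|X t x - x - t *: zeta x| <= C.

Let iz_all t x : zeta (X t x) = zeta x.
Proof.
have [t0|/ltW t0] := leP 0 t; first exact: iz.
by have := @iz (- t) _ (X t x); rewrite oppr_ge0 (flowK hb hX) => /(_ t0).
Qed.

Let zC_all t x : `|X t x - x - t *: zeta x| <= C.
Proof.
have [t0|/ltW t0] := leP 0 t; first exact: zC.
have := @zC (- t) _ (X t x); rewrite oppr_ge0 (flowK hb hX) iz_all => /(_ t0).
suff -> : X t x - x - t *: zeta x = - (x - X t x - - t *: zeta x) by rewrite normrN.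
by apply/matrixP => i j; rewrite !mxE; ring.
Qed.

Definition det2 (u v : V) : R := u 0 0 * v 1 0 - u 1 0 * v 0 0.

(** In the basis [(a, c) = (zeta x, zeta y)], the coordinates [g1 s t] and
    [- g2 s t] of [X s x - X t y] differ from [s] and [- t] by at most [M]. So
    they satisfy the sign conditions of [poincare_miranda] on a large square,
    and the two orbits meet. *)
Lemma rotation_vectors_aligned x y : det2 (zeta x) (zeta y) = 0.
Proof.
apply/eqP; apply: contraT => D0.
pose a := zeta x; pose c := zeta y; pose D := det2 a c.
pose F s t : V := X s x - X t y.
pose g1 s t := det2 (F s t) c / D.
pose g2 s t := - (det2 a (F s t) / D).
suff [s [t [g1_0 g2_0]]] : exists s t, g1 s t = 0 /\ g2 s t = 0.
  have e1 : det2 (F s t) c = 0.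
    by move/eqP: g1_0; rewrite /g1 mulf_eq0 invr_eq0 (negPf D0) orbF => /eqP.
  have e2 : det2 a (F s t) = 0.
    by move/eqP: g2_0; rewrite /g2 oppr_eq0 mulf_eq0 invr_eq0 (negPf D0) orbF => /eqP.
  have F0 : F s t = 0.
    apply/matrixP => i j; rewrite (ord1 j) [RHS]mxE; apply: (mulIf D0); rewrite mul0r.
    rewrite -/a -/c -/D.
    have -> : F s t i 0 * D = det2 (F s t) c * a i 0 + det2 a (F s t) * c i 0.
      rewrite /D /det2; have [->|->] : i = 0 \/ i = 1.
        by case: i => [[|[|//]] ilt]; [left|right]; apply: val_inj.
      ring.
      ring.
    by rewrite e1 e2 !mul0r addr0.
  move: D0; rewrite -(iz_all s x) -(iz_all t y).
  have -> : X s x = X t y by apply/eqP; rewrite -subr_eq0; apply/eqP.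
  by rewrite /det2 mulrC subrr eqxx.
have C0 : 0 <= C := le_trans (normr_ge0 _) (zC_all 0 0).
have [B B0 XB] := flow_speed hb hX.
pose er s t : V := F s t - (s *: a - t *: c).
have erM s t : `|er s t| <= `|x - y| + 2 * C.
  have -> : er s t = (x - y) + ((X s x - x - s *: a) - (X t y - y - t *: c)).
    by apply/matrixP => i j; rewrite /er /F !mxE; ring.
  apply: (le_trans (ler_normD _ _)); rewrite lerD2l.
  apply: (le_trans (ler_normB _ _)); have := zC_all s x; have := zC_all t y.
  rewrite -/a -/c; lra.
have det_le u v : `|det2 u v| <= 2 * `|u| * `|v|.
  apply: (le_trans (ler_normB _ _)); rewrite !normrM.
  have h1 := ler_pM (normr_ge0 _) (normr_ge0 _) (mx_entry_le u 0 0) (mx_entry_le v 1 0).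
  have h2 := ler_pM (normr_ge0 _) (normr_ge0 _) (mx_entry_le u 1 0) (mx_entry_le v 0 0).
  lra.
pose K0 := 2 * (`|a| + `|c|) / `|D|.
have Dn0 : 0 < `|D| by rewrite normr_gt0.
have K00 : 0 <= K0 by rewrite divr_ge0// mulr_ge0// addr_ge0.
have g1_lin u : `|det2 u c / D| <= K0 * `|u|.
  rewrite normrM normfV ler_pdivrMr// mulrAC /K0 divfK ?gt_eqF//.
  apply: (le_trans (det_le _ _)); rewrite -!mulrA ler_wpM2l//.
  by rewrite mulrC ler_wpM2r// lerDr.
have g2_lin u : `|- (det2 a u / D)| <= K0 * `|u|.
  rewrite normrN normrM normfV ler_pdivrMr// mulrAC /K0 divfK ?gt_eqF//.
  apply: (le_trans (det_le _ _)); rewrite -!mulrA ler_wpM2l//.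
  by rewrite ler_wpM2r// lerDl.
have FK s t s' t' : `|F s t - F s' t'| <= B * (`|s - s'| + `|t - t'|).
  have -> : F s t - F s' t' = (X s x - X s' x) - (X t y - X t' y).
    by apply/matrixP => i j; rewrite /F !mxE; ring.
  by apply: (le_trans (ler_normB _ _)); rewrite mulrDr lerD.
have g1K s t s' t' : `|g1 s t - g1 s' t'| <= K0 * B * (`|s - s'| + `|t - t'|).
  have -> : g1 s t - g1 s' t' = det2 (F s t - F s' t') c / D.
    by rewrite /g1 -mulrBl; congr (_ / _); rewrite /det2 !mxE; ring.
  by apply: (le_trans (g1_lin _)); rewrite -mulrA ler_wpM2l.
have g2K s t s' t' : `|g2 s t - g2 s' t'| <= K0 * B * (`|s - s'| + `|t - t'|).
  have -> : g2 s t - g2 s' t' = - (det2 a (F s t - F s' t') / D).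
    by rewrite /g2 /det2 !mxE; ring.
  by apply: (le_trans (g2_lin _)); rewrite -mulrA ler_wpM2l.
pose M := K0 * (`|x - y| + 2 * C).
have g1E s t : `|g1 s t - s| <= M.
  have -> : g1 s t - s = det2 (er s t) c / D.
    apply: (mulIf D0); rewrite -/a -/c -/D mulrBl /g1 !divfK//.
    by rewrite /er /D /det2 !mxE; ring.
  by apply: (le_trans (g1_lin _)); rewrite ler_wpM2l.
have g2E s t : `|g2 s t - t| <= M.
  have -> : g2 s t - t = - (det2 a (er s t) / D).
    apply: (mulIf D0); rewrite -/a -/c -/D mulrBl /g2 !mulNr !divfK//.
    by rewrite /er /D /det2 !mxE; ring.
  by apply: (le_trans (g2_lin _)); rewrite ler_wpM2l.
have M0 : 0 <= M by rewrite mulr_ge0// addr_ge0// mulr_ge0.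
apply: (@poincare_miranda R g1 g2 (M + 1) (K0 * B)) => //; first by lra.
- by move=> t _; have := g1E (- (M + 1)) t; rewrite ler_norml; lra.
- by move=> t _; have := g1E (M + 1) t; rewrite ler_norml; lra.
- by move=> s _; have := g2E s (- (M + 1)); rewrite ler_norml; lra.
- by move=> s _; have := g2E s (M + 1); rewrite ler_norml; lra.
Qed.

(** All values of [zeta] are multiples of one vector [e]; the coefficient is
    continuous and takes all intermediate values along segments. *)
Lemma range_convex_planar : @convex_set R V (range zeta).
Proof.
apply/convex_setP => _ _ t [x _ <-] [y _ <-] /andP[t0 t1].
suff [e [lam [clam zE]]] : exists (e : V) (lam : V -> R),
    continuous lam /\ forall z, zeta z = lam z *: e.
  pose g (r : R) := lam (y + r *: (x - y)).
  have cg : continuous g.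
    move=> r; apply: (@continuous_comp _ _ _ (fun r : R => y + r *: (x - y)) lam).
      apply: (@continuousD _ _ _ (fun=> y) (fun r : R => r *: (x - y)) r).
        exact: cst_continuous.
      exact: scalel_continuous.
    exact: clam.
  have g0 : g 0 = lam y by rewrite /g scale0r addr0.
  have g1 : g 1 = lam x by rewrite /g scale1r subrKC.
  have [||r _ gr] := @IVT R g 0 1 (t * lam x + (1 - t) * lam y) ler01.
  - exact: continuous_subspaceT.
  - rewrite g0 g1; have [xy|xy] := leP (lam y) (lam x).
      have := ler_wpM2l t0 xy; have : 0 <= 1 - t by rewrite subr_ge0.
      by move=> /ler_wpM2l/(_ _ _ xy); lra.
    have := ler_wpM2l t0 (ltW xy); have : 0 <= 1 - t by rewrite subr_ge0.
    by move=> /ler_wpM2l/(_ _ _ (ltW xy)); lra.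
  exists (y + r *: (x - y)) => //.
  by rewrite (zE (y + _)) [lam _]gr [LHS]scalerDl -!scalerA -!zE.
have [z0|/forallNP all0] := pselect (exists z, zeta z != 0); last first.
  exists 0, (fun=> 0); split=> [z|z]; first exact: cst_continuous.
  by rewrite scaler0; have /negP/negPn/eqP := all0 z.
have [z1 z1n0] := z0; pose e := zeta z1.
pose N := e 0 0 ^+ 2 + e 1 0 ^+ 2.
have N0 : N != 0.
  apply: contra z1n0; rewrite /N paddr_eq0 ?sqr_ge0// !sqrf_eq0 => /andP[/eqP h0 /eqP h1].
  apply/eqP/matrixP => i j; rewrite (ord1 j) [RHS]mxE -/e.
  have [->|->//] : i = 0 \/ i = 1 by case: i => [[|[|//]] ilt]; [left|right]; apply: val_inj.
  by [].
exists e, (fun z => (zeta z 0 0 * e 0 0 + zeta z 1 0 * e 1 0) / N); split.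
  have czi i : continuous (fun z : V => zeta z i 0).
    exact: continuous_entry.
  move=> z; apply: (@continuousM R V 
    (fun z => zeta z 0 0 * e 0 0 + zeta z 1 0 * e 1 0) (fun=> N^-1)).
    apply: (@continuousD R R V (fun z => zeta z 0 0 * e 0 0) (fun z => zeta z 1 0 * e 1 0)).
      by apply: (@continuousM R V (fun z => zeta z 0 0) (fun=> e 0 0));
        [exact: czi|exact: cst_continuous].
    by apply: (@continuousM R V (fun z => zeta z 1 0) (fun=> e 1 0));
        [exact: czi|exact: cst_continuous].
  exact: cst_continuous.
move=> z; apply/matrixP => i j; rewrite (ord1 j) !mxE; apply: (mulIf N0).
rewrite mulrAC divfK//.
have := rotation_vectors_aligned z1 z; rewrite /det2 -/e => D0.
have [->|->] : i = 0 \/ i = 1 by case: i => [[|[|//]] ilt]; [left|right]; apply: val_inj.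
- apply/eqP; rewrite -subr_eq0.
  by apply/eqP; transitivity (- e 1 0 * (e 0 0 * zeta z 1 0 - e 1 0 * zeta z 0 0));
    [rewrite /N; ring|rewrite D0 mulr0].
- apply/eqP; rewrite -subr_eq0.
  by apply/eqP; transitivity (e 0 0 * (e 0 0 * zeta z 1 0 - e 1 0 * zeta z 0 0));
    [rewrite /N; ring|rewrite D0 mulr0].
Qed.

End planar.

(** * Proof of the proposition *)

Unset Implicit Arguments.

Theorem proposition2p2 (R : realType) (d : nat) (hd : (2 <= d)%N)
    (b zeta : 'cV[R]_d -> 'cV[R]_d) (hb : C1_per b) (hzeta : C1_per zeta)
    (X : R -> 'cV[R]_d -> 'cV[R]_d) (hX : is_flow b X)
    (Phi : 'cV[R]_d -> 'cV[R]_d) (hPhi : C1 Phi) :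
  let assertion1 :=
    forall t : R, 0 <= t -> forall x : 'cV[R]_d,
      X t x = x + t *: zeta x + Phi (X t x) - Phi x in
  let assertion2 :=
    (forall x : 'cV[R]_d, (1%:M - jac Phi x) *m b x = zeta x) /\
    (forall t : R, 0 <= t ->
       on_torus zeta \o torus_flow X t = on_torus zeta) in
  (assertion1 <-> assertion2) /\
  (assertion1 \/ assertion2 ->
   (exists M : R, forall x : 'cV[R]_d, enorm (Phi x) <= M) ->
   [/\ Zd_periodic zeta,
       (3 <= d)%N -> herman_rotation_set b X = conv_hull (range (on_torus zeta)),
       d = 2%N -> herman_rotation_set b X = range (on_torus zeta) &
       exists2 C : R, 0 <= C &
         forall t : R, 0 <= t -> forall x : 'cV[R]_d,
           enorm (X t x - x - t *: zeta x) <= C]).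
Proof.
move=> a1 a2.
have pz : Zd_periodic zeta by case: hzeta.
have cz := C1_per_continuous hzeta.
have conj := linear_conjugacy_diff zeta hX hPhi.
have inv := on_torus_invariantP hb hX pz.
have a12 : a1 <-> a2 by rewrite /a1 /a2 inv.
split=> // a1_or_a2 [M PhiM].
have {a1_or_a2} ha1 : a1 by case: a1_or_a2 => // /a12.
have iz : forall t, 0 <= t -> forall x, zeta (X t x) = zeta x by case: (conj.1 ha1).
have M0 : 0 <= M := le_trans (sqrtr_ge0 _) (PhiM 0).
have zC t : 0 <= t -> forall x, `|X t x - x - t *: zeta x| <= 2 * M.
  move=> t0 x.
  have -> : X t x - x - t *: zeta x = Phi (X t x) - Phi x.
    have := ha1 t t0 x; move: (Phi (X t x)) => P.
    by move=> ->; apply/matrixP => i j; rewrite !mxE; ring.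
  apply: (le_trans (ler_normB _ _)); rewrite mulr_natl mulr2n lerD//;
    exact: le_trans (norm_le_enorm _) (PhiM _).
have hullE := herman_rotation_setE hb hX cz pz iz zC.
split=> //.
- by move=> _; rewrite range_on_torus.
- move=> d2; rewrite hullE range_on_torus//; apply: conv_hull_convex.
  clear - d2 hb hX cz iz zC; subst d.
  exact: (range_convex_planar hb hX cz iz zC).
- exists (Num.sqrt d%:R * (2 * M)) => [|t t0 x]; first by rewrite !mulr_ge0// sqrtr_ge0.
  by apply: (le_trans (enorm_le_norm _)); rewrite ler_wpM2l ?sqrtr_ge0// zC.
Qed.
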